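(* Let $n\ge 4$ and $s\ge 1$, and let $\mathcal R:B^{2,s}\otimes B^{2,1}\to B^{2,1}\otimes B^{2,s}$ be the combinatorial $R$ matrix for the $D_n^{(1)}$-crystals $B^{2,s}$, $B^{2,1}$. On the $D_n$-highest weight vectors $u_k\otimes b$ of $B^{2,s}\otimes B^{2,1}$ it is given by: (1) $\mathcal R(u_s\otimes u_1)=u_1\otimes u_s$; (2) $\mathcal R(u_{s-1}\otimes u_1)=\varnothing\otimes u_s$; (3) $\mathcal R(u_k\otimes u_1)=u_1\otimes\begin{bmatrix}1^{k+1}&\overline2\\2^{k+1}&\overline1\end{bmatrix}$ for $0\le k\le s-2$; (4) $\mathcal R\left(u_s\otimes\begin{bmatrix}1\\3\end{bmatrix}\right)=u_1\otimes\begin{bmatrix}1^{s-1}&1\\2^{s-1}&3\end{bmatrix}$; (5) $\mathcal R\left(u_k\otimes\begin{bmatrix}1\\3\end{bmatrix}\right)=u_1\otimes\begin{bmatrix}1^{k-1}&1&3\\2^{k-1}&3&\overline3\end{bmatrix}$ for $1\le k\le s-1$; (6) $\mathcal R\left(u_k\otimes\begin{bmatrix}3\\4\end{bmatrix}\right)=u_1\otimes\begin{bmatrix}1^{k-1}&3\\2^{k-1}&4\end{bmatrix}$ for $1\le k\le s$; (7) $\mathcal R\left(u_k\otimes\begin{bmatrix}3\\\overline3\end{bmatrix}\right)=u_1\otimes\begin{bmatrix}1^{k-1}&3\\2^{k-1}&\overline3\end{bmatrix}$ for $1\le k\le s$; (8) $\mathcal R\left(u_k\otimes\begin{bmatrix}1\\\overline2\end{bmatrix}\right)=u_1\otimes\begin{bmatrix}1^{k-1}&1\\2^{k-1}&\overline2\end{bmatrix}$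 for $1\le k\le s$; (9) $\mathcal R\left(u_k\otimes\begin{bmatrix}3\\\overline2\end{bmatrix}\right)=u_1\otimes\begin{bmatrix}1^{k-2}&1\\2^{k-2}&3\end{bmatrix}$ for $2\le k\le s$; (10) $\mathcal R(u_s\otimes\varnothing)=u_1\otimes u_{s-1}$; (11) $\mathcal R(u_k\otimes\varnothing)=\varnothing\otimes u_k$ for $0\le k\le s-1$; (12) $\mathcal R\left(u_1\otimes\begin{bmatrix}\overline2\\\overline1\end{bmatrix}\right)=u_1\otimes\begin{bmatrix}\overline2\\\overline1\end{bmatrix}$; (13) $\mathcal R\left(u_k\otimes\begin{bmatrix}\overline2\\\overline1\end{bmatrix}\right)=u_1\otimes u_{k-2}$ for $2\le k\le s$; (14) if $n=4$: $\mathcal R\left(u_k\otimes\begin{bmatrix}3\\\overline4\end{bmatrix}\right)=u_1\otimes\begin{bmatrix}1^{k-1}&3\\2^{k-1}&\overline4\end{bmatrix}$ for $1\le k\le s$.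
   Context: Letters. $\mathcal B=\{1,\dots,n,\overline n,\dots,\overline1\}$ is the $D_n$-crystal of the vector representation: for $1\le i\le n-1$, $\tilde f_i$ sends $i\mapsto i+1$, $\overline{i+1}\mapsto\overline i$; $\tilde f_n$ sends $n-1\mapsto\overline n$, $n\mapsto\overline{n-1}$; all other values are $0$; $\tilde e_i$ is the partial inverse of $\tilde f_i$. The weight of $i$ is $\delta_i$ and of $\overline i$ is $-\delta_i$, where $\delta_1,\dots,\delta_n$ is the standard basis of $\mathbb Z^n$. Throughout, $\varepsilon_i(b)=\max\{m:\tilde e_i^m b\ne0\}$, $\varphi_i(b)=\max\{m:\tilde f_i^mb\neq0\}$. Tensor products. $\tilde e_i(b_1\otimes b_2)=\tilde e_ib_1\otimes b_2$ if $\varphi_i(b_1)\ge\varepsilon_i(b_2)$ and $b_1\otimes\tilde e_ib_2$ otherwise; $\tilde f_i(b_1\otimes b_2)=\tilde f_ib_1\otimes b_2$ if $\varphi_i(b_1)>\varepsilon_i(b_2)$ and $b_1\otimes\tilde f_ib_2$ otherwise; weights add. Tableaux. A $2\times k$ tableau with rows $T_{1,1},\dots,T_{1,k}$ and $T_{2,1},\dots,T_{2,k}$ is identified with the word $T_{1,k}\otimes T_{2,k}\otimes T_{1,k-1}\otimes T_{2,k-1}\otimes\cdots\otimes T_{1,1}\otimes T_{2,1}$. $B(k\Lambda_2)$ is the $D_n$-crystal of (Kashiwara–Nakashima) tableaux forming the connected component (under $\tilde e_i,\tilde f_i$, $1\le i\le n$) of the word of the tableau $u_k$ all of whose $k$ columns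 are $\begin{bmatrix}1\\2\end{bmatrix}$; $B(0)=\{\varnothing\}$, $u_0=\varnothing$. In matrix notation, an entry column with exponent $j$ (e.g. $\begin{bmatrix}1^{j}\\2^{j}\end{bmatrix}$) means that the column is repeated $j$ times (omitted if $j=0$). The $D_n^{(1)}$-crystal $B^{2,s}$. As a $D_n$-crystal $B^{2,s}=\bigsqcup_{k=0}^sB(k\Lambda_2)$. An element of $B(k\Lambda_2)$ killed by $\tilde e_2,\dots,\tilde e_n$ has weight $w\delta_1+\lambda_1\delta_2+\lambda_2\delta_3$ with $k\ge\lambda_1\ge\lambda_2\ge0$, $w\in\{-(\lambda_1-\lambda_2),-(\lambda_1-\lambda_2)+2,\dots,\lambda_1-\lambda_2\}$, and it is uniquely determined by $(k,\lambda_1,\lambda_2,w)$, all such values occurring. Let $\sigma:B^{2,s}\to B^{2,s}$ be the involution that commutes with $\tilde e_i,\tilde f_i$ for $2\le i\le n$ and sends the element with parameters $(k,\lambda_1,\lambda_2,w)$ to the one with parameters $(s+\lambda_1-k,\lambda_1,\lambda_2,-w)$. Then $\tilde e_0=\sigma\tilde e_1\sigma$, $\tilde f_0=\sigma\tilde f_1\sigma$ (with $\sigma(0)=0$). Combinatorial $R$. $\mathcal R:B^{2,s}\otimes B^{2,1}\to B^{2,1}\otimes B^{2,s}$ is the unique crystal isomorphism, i.e. the unique bijection commuting with all $\tilde e_i,\tilde f_i$, $0\le i\le n$. A $D_n$-highest weight vector is an element killed by $\tilde e_1,\dots,\tilde e_n$; those of $B^{2,s}\otimes B^{2,1}$ are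 the elements $u_k\otimes b$ whose images are listed in the claim. *)

(* Defs.v *)
From HB Require Import structures.
From mathcomp Require Import all_boot all_order all_algebra.

Set Implicit Arguments.
Unset Strict Implicit.
Unset Printing Implicit Defensive.

(* The weight lattice is Z^n, with [delta n i] the i-th standard basis vector,
   1 <= i <= n. *)
Definition delta (n i : nat) : 'rV[int]_n := (\row_(j < n) (j.+1 == i)%:R)%R.

(* The operators are indexed by all natural numbers: a D_n-crystal only uses
   the indices 1, ..., n, a D_n^(1)-crystal the indices 0, ..., n.  [None] is
   the symbol 0 of crystal theory. *)
Record crystal (n : nat) := Crystal {
  car :> finType;
  wt : car -> 'rV[int]_n;
  ee : nat -> car -> option car;
  ff : nat -> car -> option car
}.

(* max {m | g^m b <> 0}.  If this set is finite, g^m b <> 0 forces m < #|T|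
   (otherwise the orbit of b would be cyclic), so the bound loses nothing. *)
Definition depth (T : finType) (g : T -> option T) (b : T) : nat :=
  \max_(m < #|T|.+1 | isSome (iter m (obind g) (Some b))) m.

Section CrystalOps.
Variable n : nat.

Definition eps (B : crystal n) (i : nat) (b : B) : nat := depth (@ee n B i) b.
Definition phi (B : crystal n) (i : nat) (b : B) : nat := depth (@ff n B i) b.

Definition tens (B1 B2 : crystal n) : crystal n :=
  @Crystal n (B1 * B2)%type
    (fun b => wt b.1 + wt b.2)%R
    (fun i b => if eps i b.2 <= phi i b.1
                then omap (fun x => (x, b.2)) (ee i b.1)
                else omap (fun y => (b.1, y)) (ee i b.2))
    (fun i b => if eps i b.2 < phi i b.1
                then omap (fun x => (x, b.2)) (ff i b.1)
                else omap (fun y => (b.1, y)) (ff i b.2)).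

Definition trivial_crystal : crystal n :=
  @Crystal n unit (fun=> 0%R) (fun _ _ => None) (fun _ _ => None).

(* B (x) (B (x) (... (x) (B (x) trivial))), with m factors B. *)
Fixpoint tpow (B : crystal n) (m : nat) : crystal n :=
  if m is m'.+1 then tens B (tpow B m') else trivial_crystal.

Definition subcrystal (B : crystal n) (P : pred B) : crystal n :=
  @Crystal n {x : B | P x}
    (fun b => wt (val b))
    (fun i b => obind insub (ee i (val b)))
    (fun i b => obind insub (ff i (val b))).

Definition dunion (I : finType) (B : I -> crystal n) : crystal n :=
  @Crystal n {k : I & B k}
    (fun b => wt (tagged b))
    (fun i b => omap (fun x => Tagged (fun k => B k) x) (ee i (tagged b)))
    (fun i b => omap (fun x => Tagged (fun k => B k) x) (ff i (tagged b))).

Definition Dn_step (B : crystal n) : rel B :=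
  [rel x y | has (fun i => (ee i x == Some y) || (ff i x == Some y)) (iota 1 n)].

End CrystalOps.

(* [pos i] is the letter i, [bar i] the letter \overline i. *)
Definition label : Type := (nat * bool)%type.
Definition pos (i : nat) : label := (i, false).
Definition bar (i : nat) : label := (i, true).

(* Ordinals start at 0: (i, false) encodes i.+1 and (i, true) its bar. *)
Definition letter (n : nat) : finType := ('I_n * bool)%type.
Definition lab (n : nat) (x : letter n) : label := (x.1.+1, x.2).

Definition label_arrow (n i : nat) (x y : label) : bool :=
  if 1 <= i < n then
    ((x == pos i) && (y == pos i.+1)) || ((x == bar i.+1) && (y == bar i))
  else
    (i == n) && (((x == pos n.-1) && (y == bar n)) ||
                 ((x == pos n) && (y == bar n.-1))).

Definition letter_crystal (n : nat) : crystal n :=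
  @Crystal n (letter n)
    (fun x => if x.2 then - delta n x.1.+1 else delta n x.1.+1)%R
    (fun i y => [pick x | label_arrow n i (lab x) (lab y)])
    (fun i x => [pick y | label_arrow n i (lab x) (lab y)]).

(* A two-row tableau is the list of its columns (top entry, bottom entry), from
   left to right. *)
Definition tableau : Type := seq (label * label).

Definition word (n k : nat) : crystal n := tpow (letter_crystal n) k.*2.

(* The word of a tableau reads its columns from right to left, each one from
   top to bottom. *)
Fixpoint tab_of_word (n k : nat) : word n k -> tableau :=
  if k is k'.+1
  then fun w : letter n * (letter n * word n k') =>
         rcons (tab_of_word w.2.2) (lab w.1, lab w.2.1)
  else fun=> [::].

Definition column (a b : label) : label * label := (a, b).

Definition utab (k : nat) : tableau := nseq k (column (pos 1) (pos 2)).

(* The connected component of the word of u_k. *)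
Definition in_BkLambda2 (n k : nat) : pred (word n k) :=
  fun x => [exists y : word n k,
    (tab_of_word y == utab k) && connect (@Dn_step n (word n k)) y x].

Definition BkLambda2 (n k : nat) : crystal n := subcrystal (@in_BkLambda2 n k).

(* B^{2,s} as a D_n-crystal. *)
Definition B2_classical (n s : nat) : crystal n :=
  dunion (fun k : 'I_s.+1 => BkLambda2 n k).

Definition tab (n s : nat) (b : B2_classical n s) : tableau :=
  tab_of_word (val (tagged b)).

Definition has_params (n s : nat) (b : B2_classical n s)
    (k l1 l2 : nat) (w : int) : Prop :=
  [/\ forall i, 2 <= i <= n -> ee i b = None,
      nat_of_ord (tag b) = k &
      wt b = (w *: delta n 1 + l1%:Z *: delta n 2 + l2%:Z *: delta n 3)%R].

(* The subtraction is not truncated, as k <= s. *)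
Definition is_sigma (n s : nat)
    (sigma : B2_classical n s -> B2_classical n s) : Prop :=
  [/\ involutive sigma,
      forall i, 2 <= i <= n -> forall b,
        ee i (sigma b) = omap sigma (ee i b) /\
        ff i (sigma b) = omap sigma (ff i b) &
      forall b k l1 l2 w, has_params b k l1 l2 w ->
        has_params (sigma b) (s + l1 - k) l1 l2 (- w)%R].

(* B^{2,s} as a D_n^(1)-crystal. *)
Definition B2 (n s : nat) (sigma : B2_classical n s -> B2_classical n s) :
    crystal n :=
  @Crystal n (car (B2_classical n s)) (@wt n (B2_classical n s))
    (fun i b => if i == 0 then omap sigma (ee 1 (sigma b)) else ee i b)
    (fun i b => if i == 0 then omap sigma (ff 1 (sigma b)) else ff i b).

Definition affine_crystal_iso (n : nat) (B B' : crystal n) (R : B -> B') :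
    Prop :=
  bijective R /\
  forall i, i <= n -> forall b,
    ee i (R b) = omap R (ee i b) /\ ff i (R b) = omap R (ff i b).

(* R (t1 (x) t2) = t1' (x) t2', where the tableaux t1 and t2 are asserted to
   lie in B^{2,s} and B^{2,s'}.  An element is determined by its tableau. *)
Definition sends (n s s' : nat)
    (R : B2_classical n s * B2_classical n s' ->
         B2_classical n s' * B2_classical n s)
    (t1 t2 t1' t2' : tableau) : Prop :=
  exists b1 b2, [/\ tab b1 = t1, tab b2 = t2,
    tab (R (b1, b2)).1 = t1' & tab (R (b1, b2)).2 = t2'].

(* Main.v *)
Require Import Defs.
From mathcomp Require Import all_boot all_order all_algebra.
From Stdlib Require Import Lia.
Set Implicit Arguments.
Unset Strict Implicit.
Unset Printing Implicit Defensive.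
Import GRing.Theory.

(* An element of B(k Lambda_2) is a word of 2k letters, and it lies in the
   component of u_k iff any two adjacent columns satisfy the conditions [cols_ok]
   of Kashiwara and Nakashima: these conditions are preserved by the crystal
   operators, and force a highest weight word to be u_k.  With the same conditions
   the elements killed by e_2, ..., e_n and of weight 0 in the directions
   delta_3, ..., delta_n are the explicit words [jtab], and they are separated by
   their parameters; this determines sigma on them, hence e_0 on the u_k and
   phi_0 on a few other elements.

   R matches highest weight vectors with highest weight vectors and preserves
   phi_0, ..., phi_n; the highest weight vectors u_k (x) b are easily listed.
   Comparing phi_1, ..., phi_4 leaves one candidate preimage in cases (1), (4),
   (6), (8) and (14).  Applying e_0 to (1) gives (10) and (13); in case (2) the
   wrong candidate is excluded by following its e_0-string, and applying e_0
   gives (11); the values of phi_0 settle (3) and (9); the remaining cases follow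
   by elimination. *)

(** * Words and columns *)

(** The weight alone cannot separate the candidates: u_k (x) empty, u_{k-1} (x) u_1, u_k (x)
    [3; bar 3] and u_{k+1} (x) [bar 2; bar 1] all have weight k Lambda_2, and u_k (x) [1; 3] has the
    weight of u_{k+1} (x) [3; bar 2]. Only the 0-arrows tell them apart, and these depend on sigma,
    which is given by its axioms alone. Sigma is never computed in general: its value on an element
    killed by e_2, ..., e_n is read off from the parameters, then carried by the f_i with i >= 2 to
    the few tableaux whose 0-strings are needed. Since n and s are arbitrary, nothing can be
    enumerated. Words therefore become lists of integers, on which closure under the operators is a
    question of linear arithmetic about at most four letters. *)

Section Words.
Variable n : nat.

(* Letters are encoded by 1, ..., 2n: the letter j by j and its bar by 2n + 1 - j.
   [letter_plus i p] and [letter_minus i p] say that f_i, respectively e_i, does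
   not kill the letter p; f_i then adds [letter_jump i] to it. *)
Definition letter_plus (i p : nat) : bool :=
  (0 < i < n) && ((p == i) || (p + i == n.*2)) ||
  (i == n) && ((p.+1 == n) || (p == n)).
Definition letter_minus (i p : nat) : bool :=
  (0 < i < n) && ((p == i.+1) || (p + i == n.*2.+1)) ||
  (i == n) && ((p == n.+1) || (p == n.+2)).
Definition letter_jump (i : nat) : nat := if i == n then 2 else 1.

(** Truncated subtraction is the maximum in the tensor product formula eps(b1 (x) b2) = eps(b1) +
    max(0, eps(b2) - phi(b1)) and its analogue for phi; a single letter has eps and phi at most
    1. *)
Fixpoint word_eps (i : nat) (w : seq nat) : nat :=
  if w is p :: w' then letter_minus i p + (word_eps i w' - letter_plus i p) else 0.
Fixpoint word_phi (i : nat) (w : seq nat) : nat :=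
  if w is p :: w' then word_phi i w' + (letter_plus i p - word_eps i w') else 0.
Fixpoint word_e (i : nat) (w : seq nat) : option (seq nat) :=
  if w is p :: w' then
    if word_eps i w' <= letter_plus i p then
      if letter_minus i p then Some (p - letter_jump i :: w') else None
    else omap (cons p) (word_e i w')
  else None.
Fixpoint word_f (i : nat) (w : seq nat) : option (seq nat) :=
  if w is p :: w' then
    if word_eps i w' < letter_plus i p then Some (p + letter_jump i :: w')
    else omap (cons p) (word_f i w')
  else None.

(** * Closure of the one- and two-column conditions *)

Section Closure.
Hypothesis hn : (4 <= n)%coq_nat.
Local Open Scope coq_nat_scope.

Definition quad (P : nat -> nat -> nat -> nat -> Prop) (w : seq nat) : Prop :=
  if w is [:: a; b; c; d] then P a b c d else False.
Definition pair2 (P : nat -> nat -> Prop) (w : seq nat) : Prop :=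
  if w is [:: a; b] then P a b else False.

(* [or2] and [locked_prop] hide disjunctions from [lia], whose running time they
   would multiply. *)
Variant or2 (A B : Prop) : Prop := Or2L of A | Or2R of B.

Variant locked_prop (A : Prop) : Prop := LockProp of A.

(* A pair of adjacent columns is written (a, b), (c, d) in reading order, so that
   (a, b) is the column on the right. *)
Variant col_spec (a b : nat) : Prop :=
  ColSpec of 0 < a & a <= (n + n)%coq_nat & 0 < b & b <= (n + n)%coq_nat
    & or2 (a < b) (a = n.+1 /\ b = n) & or2 (1 < a) (b < (n + n)%coq_nat).
(** The codes n and n + 1 are consecutive, but n and bar n are incomparable letters: a row may not
    contain n followed by bar n, while a column admits both orders. *)
Variant row_spec (p q : nat) : Prop :=
  RowSpec of p <= q & locked_prop (p = n -> q = n.+1 -> False).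
(** Two codes with sum 2n + 1 are bars of each other. Beyond the row conditions, three pairs of
    columns (left, right) are forbidden: [a; d] [a; bar a], then [c; bar c] [a; bar c], and [n-1; x]
    [x; bar (n-1)] with x equal to n or bar n. *)
Variant cols_spec (a b c d : nat) : Prop :=
  ColsSpec of col_spec a b & col_spec c d & row_spec c a & row_spec d b
    & locked_prop (a = c -> (a + b)%coq_nat = (n + n)%coq_nat.+1 -> False)
    & locked_prop (b = d -> (c + d)%coq_nat = (n + n)%coq_nat.+1 -> False)
    & locked_prop (c.+1 = n -> b = n.+2 -> a = d -> a = n \/ a = n.+1 -> False).

(* The sign of the letter [p] for [i < n]; the intervals are kept apart so that
   the cases are linear. *)
Variant class (i p : nat) : bool -> bool -> Prop :=
| Class0 of p < i : class i p false false
| Class1 of p = i : class i p true false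
| Class2 of p = i.+1 : class i p false true
| Class3 of i.+1 < p & (p + i)%coq_nat < (n + n)%coq_nat : class i p false false
| Class4 of (p + i)%coq_nat = (n + n)%coq_nat : class i p true false
| Class5 of (p + i)%coq_nat = (n + n)%coq_nat.+1 : class i p false true
| Class6 of (n + n)%coq_nat.+1 < (p + i)%coq_nat : class i p false false.

Variant classn (p : nat) : bool -> bool -> Prop :=
| Classn0 of p.+1 < n : classn p false false
| Classn1 of p.+1 = n : classn p true false
| Classn2 of p = n : classn p true false
| Classn3 of p = n.+1 : classn p false true
| Classn4 of p = n.+2 : classn p false true
| Classn5 of n.+2 < p : classn p false false.

Ltac prune := try (exfalso; lia).
Ltac split_or := repeat match goal with H : or2 _ _ |- _ => destruct H as [H|H]; prune end.
Ltac solve_lin := first [lia | multimatch goal with H : locked_prop _ |- _ => destruct H as [H]; lia end].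
Ltac solve_or := first [left; lia | right; lia].
Ltac finish_ok := simpl;
  repeat match goal with |- cols_spec _ _ _ _ => split | |- col_spec _ _ => split
    | |- row_spec _ _ => split | |- locked_prop _ => first [assumption | split; intros] end;
  lazymatch goal with
  | |- or2 _ _ => first [assumption | solve_or | split_or; solve_or]
  | |- _ => first [assumption | solve_lin | split_or; solve_lin]
  end.
Ltac use_eq := simpl; rewrite -?minusE -?plusE; match goal with
  | |- None = Some _ -> _ => discriminate
  | |- Some _ = Some _ -> _ => case=> <- end.

(** Contradictory cases are pruned after each letter, so the 7^4 combinations for four letters are
    never all expanded. *)
Ltac cls H := case: H => [?|?|?|? ?|?|?|?]; prune.
Ltac clsn H := case: H => [?|?|?|?|?|?]; prune.

Lemma col_spec_e_lt i a b w : 0 < i /\ i < n ->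
  class i a (letter_plus i a) (letter_minus i a) -> class i b (letter_plus i b) (letter_minus i b) ->
  col_spec a b -> word_e i [:: a; b] = Some w -> pair2 col_spec w.
Proof.
move=> hin ha hb [a1 a2 b1 b2 ab ab'].
rewrite /= /letter_jump (_ : (i == n) = false); last by apply/eqP; lia.
cls ha; cls hb; use_eq; finish_ok.
Qed.

Lemma col_spec_en a b w :
  classn a (letter_plus n a) (letter_minus n a) -> classn b (letter_plus n b) (letter_minus n b) ->
  col_spec a b -> word_e n [:: a; b] = Some w -> pair2 col_spec w.
Proof.
move=> ha hb [a1 a2 b1 b2 ab ab'].
rewrite /= /letter_jump eqxx; clsn ha; clsn hb; use_eq; finish_ok.
Qed.

Lemma cols_spec_e_lt i a b c d w : 0 < i /\ i < n ->
  class i a (letter_plus i a) (letter_minus i a) -> class i b (letter_plus i b) (letter_minus i b) ->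
  class i c (letter_plus i c) (letter_minus i c) -> class i d (letter_plus i d) (letter_minus i d) ->
  cols_spec a b c d -> word_e i [:: a; b; c; d] = Some w -> quad cols_spec w.
Proof.
move=> hin ha hb hc hd.
move=> [[a1 a2 b1 b2 ab ab'] [c1 c2 d1 d2 cd cd'] [ca ca'] [db db'] E1 E2 E3].
rewrite /= /letter_jump (_ : (i == n) = false); last by apply/eqP; lia.
cls ha; cls hb; cls hc; cls hd; use_eq; finish_ok.
Qed.

Lemma cols_spec_en a b c d w :
  classn a (letter_plus n a) (letter_minus n a) -> classn b (letter_plus n b) (letter_minus n b) ->
  classn c (letter_plus n c) (letter_minus n c) -> classn d (letter_plus n d) (letter_minus n d) ->
  cols_spec a b c d -> word_e n [:: a; b; c; d] = Some w -> quad cols_spec w.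
Proof.
move=> ha hb hc hd.
move=> [[a1 a2 b1 b2 ab ab'] [c1 c2 d1 d2 cd cd'] [ca ca'] [db db'] E1 E2 E3].
rewrite /= /letter_jump eqxx; clsn ha; clsn hb; clsn hc; clsn hd; use_eq; finish_ok.
Qed.

Lemma col_spec_f_lt i a b w : 0 < i /\ i < n ->
  class i a (letter_plus i a) (letter_minus i a) -> class i b (letter_plus i b) (letter_minus i b) ->
  col_spec a b -> word_f i [:: a; b] = Some w -> pair2 col_spec w.
Proof.
move=> hin ha hb [a1 a2 b1 b2 ab ab'].
rewrite /= /letter_jump (_ : (i == n) = false); last by apply/eqP; lia.
cls ha; cls hb; use_eq; finish_ok.
Qed.

Lemma col_spec_fn a b w :
  classn a (letter_plus n a) (letter_minus n a) -> classn b (letter_plus n b) (letter_minus n b) ->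
  col_spec a b -> word_f n [:: a; b] = Some w -> pair2 col_spec w.
Proof.
move=> ha hb [a1 a2 b1 b2 ab ab'].
rewrite /= /letter_jump eqxx; clsn ha; clsn hb; use_eq; finish_ok.
Qed.

Lemma cols_spec_f_lt i a b c d w : 0 < i /\ i < n ->
  class i a (letter_plus i a) (letter_minus i a) -> class i b (letter_plus i b) (letter_minus i b) ->
  class i c (letter_plus i c) (letter_minus i c) -> class i d (letter_plus i d) (letter_minus i d) ->
  cols_spec a b c d -> word_f i [:: a; b; c; d] = Some w -> quad cols_spec w.
Proof.
move=> hin ha hb hc hd.
move=> [[a1 a2 b1 b2 ab ab'] [c1 c2 d1 d2 cd cd'] [ca ca'] [db db'] E1 E2 E3].
rewrite /= /letter_jump (_ : (i == n) = false); last by apply/eqP; lia.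
cls ha; cls hb; cls hc; cls hd; use_eq; finish_ok.
Qed.

Lemma cols_spec_fn a b c d w :
  classn a (letter_plus n a) (letter_minus n a) -> classn b (letter_plus n b) (letter_minus n b) ->
  classn c (letter_plus n c) (letter_minus n c) -> classn d (letter_plus n d) (letter_minus n d) ->
  cols_spec a b c d -> word_f n [:: a; b; c; d] = Some w -> quad cols_spec w.
Proof.
move=> ha hb hc hd.
move=> [[a1 a2 b1 b2 ab ab'] [c1 c2 d1 d2 cd cd'] [ca ca'] [db db'] E1 E2 E3].
rewrite /= /letter_jump eqxx; clsn ha; clsn hb; clsn hc; clsn hd; use_eq; finish_ok.
Qed.

End Closure.
End Words.

From mathcomp Require Import zify.

(** * Computing eps and phi through a model of the crystal *)

Section Depth.
Variables (T : finType) (X : Type) (g : T -> option T) (g' : X -> option X).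
Variables (h : T -> X) (m : X -> nat).
Hypothesis gh : forall b, omap h (g b) = g' (h b).
Hypothesis mS : forall x x', g' x = Some x' -> m x = (m x').+1.
Hypothesis m0 : forall x, g' x = None -> m x = 0.

Lemma isSome_iter b j : isSome (iter j (obind g) (Some b)) = (j <= m (h b)).
Proof.
elim: j b => // j IH b; rewrite iterSr /=.
case gb: (g b) => [b'|].
  by rewrite IH (@mS (h b) (h b')) // -gh gb.
rewrite (_ : m (h b) = 0); last by apply: m0; rewrite -gh gb.
rewrite ltn0.
by elim: j {IH} => //= j; case: (iter j _ _).
Qed.

Lemma depth_surj b j : j <= m (h b) -> exists x, m (h x) = j.
Proof.
elim: {b}(m (h b)) {-2}b (leqnn (m (h b))) => [|k IH] b hk hj.
  by exists b; lia.
have [->|hj'] := eqVneq j (m (h b)); first by exists b.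
case gb: (g b) => [b'|]; last by have := @m0 (h b); rewrite -gh gb => /(_ erefl); lia.
by have := @mS (h b) (h b'); rewrite -gh gb => /(_ erefl) e; apply: (IH b'); lia.
Qed.

(** By [depth_surj] the string below b takes every value of m up to m (h b), so m (h b) < #|T| and
    the bound in [depth] cuts nothing off. *)
Lemma depth_model b : depth g b = m (h b).
Proof.
have hT : m (h b) <= #|T|.
  have : {subset iota 0 (m (h b)).+1 <= [seq m (h x) | x : T]}.
    move=> j; rewrite mem_iota => hj.
    have [|x <-] := @depth_surj b j; first by lia.
    by apply: map_f; rewrite mem_enum.
  move/(uniq_leq_size (iota_uniq _ _)).
  by rewrite size_iota size_map -cardE; apply: ltnW.
apply/eqP; rewrite eqn_leq; apply/andP; split.
  by apply/bigmax_leqP => j; rewrite isSome_iter.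
have hlt : m (h b) < #|T|.+1 by [].
by apply: (leq_bigmax_cond (Ordinal hlt)); rewrite isSome_iter.
Qed.
End Depth.

(** * The signature rule on words of codes *)

Section Crystals.
Variable n : nat.
Hypothesis hn : 4 <= n.
Local Notation plus := (letter_plus n).
Local Notation minus := (letter_minus n).
Local Notation jump := (letter_jump n).
Local Notation weps := (word_eps n).
Local Notation wphi := (word_phi n).
Local Notation we := (word_e n).
Local Notation wf := (word_f n).

Lemma plus_minusF i p : plus i p -> minus i p = false.
Proof. rewrite /letter_plus /letter_minus; lia. Qed.

Lemma minus_plusF i p : minus i p -> plus i p = false.
Proof. rewrite /letter_plus /letter_minus; lia. Qed.

Lemma plus_jump i p : plus i p -> minus i (p + jump i).
Proof. rewrite /letter_plus /letter_minus /letter_jump; case: ifP; lia. Qed.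

Lemma minus_jump i p : minus i p -> plus i (p - jump i) /\ jump i <= p.
Proof. rewrite /letter_plus /letter_minus /letter_jump; case: ifP; lia. Qed.

Lemma we_None i w : (we i w == None) = (weps i w == 0).
Proof.
elim: w => //= p w IH.
case: leqP => h; first by rewrite (eqP h) addn0; case: (minus i p).
case: (we i w) IH => [w'|] /= /esym IH; first by apply/esym/negbTE; lia.
by move: h; rewrite (eqP IH).
Qed.

Lemma wf_None i w : (wf i w == None) = (wphi i w == 0).
Proof.
elim: w => //= p w IH.
case: ltnP => h; first by apply/esym/negbTE; lia.
by rewrite (eqP h) addn0 -IH; case: (wf i w).
Qed.

Lemma we_Some i w w' : we i w = Some w' ->
  [/\ wf i w' = Some w, weps i w = (weps i w').+1 & wphi i w' = (wphi i w).+1].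
Proof.
elim: w w' => //= p w IH w'.
case: leqP => h.
  case: ifP => // mp [<-] /=.
  have [pj jp] := minus_jump mp.
  rewrite pj (plus_minusF pj) (minus_plusF mp).
  move: h; rewrite (minus_plusF mp) leqn0 => /eqP ->; rewrite subnK //.
  by split=> //; lia.
case ew: (we i w) => [w1|] //= [<-] /=.
have [-> e1 e2] := IH _ ew.
have -> : (weps i w1 < plus i p) = false by lia.
by split=> //; lia.
Qed.

Lemma wf_Some i w w' : wf i w = Some w' -> we i w' = Some w.
Proof.
elim: w w' => //= p w IH w'.
case: ltnP => h.
  case=> <- /=.
  have pp: plus i p by case: (plus i p) h; lia.
  have mj := plus_jump pp.
  rewrite mj (minus_plusF mj); rewrite pp in h.
  have -> : weps i w <= false by lia.
  by rewrite addnK.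
case ew: (wf i w) => [w1|] //= [<-] /=.
have h1 := IH _ ew.
have [_ e1 _] := we_Some h1.
have -> : (weps i w1 <= plus i p) = false by lia.
by rewrite h1.
Qed.

Lemma weps_cat i u v : weps i (u ++ v) = weps i u + (weps i v - wphi i u).
Proof.
elim: u v => [|p u IH] v /=; first by lia.
by rewrite IH; lia.
Qed.

Lemma wphi_cat i u v : wphi i (u ++ v) = wphi i v + (wphi i u - weps i v).
Proof.
elim: u v => [|p u IH] v /=; first by lia.
by rewrite IH weps_cat; lia.
Qed.

(** Associativity of the tensor product: words are built letter by letter, but the arguments split
    them into columns, blocks of columns and tensor factors. *)
Lemma we_cat i u v : we i (u ++ v) =
  if weps i v <= wphi i u then omap (cat^~ v) (we i u) else omap (cat u) (we i v).
Proof.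
elim: u v => [|p u IH] v /=.
  case: leqP => [h|_]; last by case: (we i v).
  have : we i v == None by rewrite we_None; lia.
  by move/eqP.
rewrite IH weps_cat.
case: (leqP (weps i v) (wphi i u)) => h1.
  have -> : weps i u + (weps i v - wphi i u) = weps i u by lia.
  have -> : weps i v <= wphi i u + (plus i p - weps i u) by lia.
  case: ifP => // _; first by case: ifP.
  by case: (we i u).
case: (leqP (weps i u) (plus i p)) => h2.
  case: (leqP (weps i v) _) => h3.
    have -> : weps i u + (weps i v - wphi i u) <= plus i p by lia.
    by case: ifP.
  have -> : (weps i u + (weps i v - wphi i u) <= plus i p) = false by lia.
  by case: (we i v).
have -> : (weps i u + (weps i v - wphi i u) <= plus i p) = false by lia.
have -> : (weps i v <= wphi i u + (plus i p - weps i u)) = false by lia.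
by case: (we i v).
Qed.

Lemma wf_cat i u v : wf i (u ++ v) =
  if weps i v < wphi i u then omap (cat^~ v) (wf i u) else omap (cat u) (wf i v).
Proof.
elim: u v => [|p u IH] v /=.
  by case: (wf i v).
rewrite IH weps_cat.
case: (ltnP (weps i v) (wphi i u)) => h1.
  have -> : weps i u + (weps i v - wphi i u) = weps i u by lia.
  have -> : weps i v < wphi i u + (plus i p - weps i u) by lia.
  case: ifP => // _; by case: (wf i u).
case: (ltnP (weps i u) (plus i p)) => h2.
  case: (ltnP (weps i v) _) => h3.
    by have -> : weps i u + (weps i v - wphi i u) < plus i p by lia.
  have -> : (weps i u + (weps i v - wphi i u) < plus i p) = false by lia.
  by case: (wf i v).
have -> : (weps i u + (weps i v - wphi i u) < plus i p) = false by lia.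
have -> : (weps i v < wphi i u + (plus i p - weps i u)) = false by lia.
by case: (wf i v).
Qed.

(** * Boolean form of the column conditions *)

Definition col_ok (a b : nat) : bool :=
  [&& 0 < a <= n + n, 0 < b <= n + n, (a < b) || (a == n.+1) && (b == n)
    & (1 < a) || (b < n + n)].
Definition row_le (p q : nat) : bool := (p <= q) && ~~ ((p == n) && (q == n.+1)).
Definition cols_ok (a b c d : nat) : bool :=
  [&& col_ok a b, col_ok c d, row_le c a, row_le d b,
      ~~ ((a == c) && (a + b == (n + n).+1)),
      ~~ ((b == d) && (c + d == (n + n).+1)) &
      ~~ [&& c.+1 == n, b == n.+2, a == d & (a == n) || (a == n.+1)]].

Local Open Scope coq_nat_scope.
Lemma col_okP a b : reflect (col_spec n a b) (col_ok a b).
Proof.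
apply: (iffP and4P) => [[h1 h2 h3 h4]|[h1 h2 h3 h4 h5 h6]].
  split; try lia; first by case/orP: h3 => h; [left|right]; lia.
  by case/orP: h4 => h; [left|right]; lia.
by split; try lia; [case: h5 => h|case: h6 => h]; lia.
Qed.

Lemma row_leP p q : reflect (row_spec n p q) (row_le p q).
Proof.
by apply: (iffP andP) => [[h1 h2]|[h1 [h2]]]; split; try split; lia.
Qed.

Lemma cols_okP a b c d : reflect (cols_spec n a b c d) (cols_ok a b c d).
Proof.
apply: (iffP idP) => [/and5P[/col_okP h1 /col_okP h2 /row_leP h3 /row_leP h4]|].
  by case/and3P=> h5 h6 h7; split=> //; split; lia.
case=> /col_okP h1 /col_okP h2 /row_leP h3 /row_leP h4 [h5] [h6] [h7].
by rewrite /cols_ok h1 h2 h3 h4 /=; apply/and3P; split; lia.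
Qed.

Lemma classP i p : 0 < i /\ i < n -> class n i p (plus i p) (minus i p).
Proof.
move=> hi.
have -> : plus i p = (p == i) || (p + i == n + n)%N by rewrite /letter_plus; lia.
have -> : minus i p = (p == i.+1) || (p + i == (n + n).+1)%N by rewrite /letter_minus; lia.
case: (ltngtP p i) => h1.
- have -> : (p + i == n + n)%N = false by lia.
  have -> : (p == i.+1) = false by lia.
  have -> : (p + i == (n + n).+1)%N = false by lia.
  by apply: Class0; lia.
- case: (ltngtP p i.+1) => h2; first by lia.
  + case: (ltngtP (p + i)%N (n + n)) => h3.
    * have -> : (p + i == (n + n).+1)%N = false by lia.
      by apply: Class3; lia.
    * case: (ltngtP (p + i)%N (n + n).+1) => h4; first by lia.
        by apply: Class6; lia.
      by apply: Class5; lia.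
    * have -> : (p + i == (n + n).+1)%N = false by lia.
      by apply: Class4; lia.
  + have -> : (p + i == n + n)%N = false by lia.
    by apply: Class2; lia.
have -> : (p == i.+1) = false by lia.
have -> : (p + i == (n + n).+1)%N = false by lia.
by apply: Class1.
Qed.

Lemma classnP p : classn n p (plus n p) (minus n p).
Proof.
have -> : plus n p = (p.+1 == n) || (p == n) by rewrite /letter_plus; lia.
have -> : minus n p = (p == n.+1) || (p == n.+2) by rewrite /letter_minus; lia.
case: (ltngtP p.+1 n) => h1.
- have -> : (p == n) = false by lia.
  have -> : (p == n.+1) = false by lia.
  have -> : (p == n.+2) = false by lia.
  by apply: Classn0; lia.
- case: (ltngtP p n) => h2; first by lia.
    case: (ltngtP p n.+1) => h3; first by lia.
      case: (ltngtP p n.+2) => h4; first by lia.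
        by apply: Classn5; lia.
      by apply: Classn4.
    have -> : (p == n.+2) = false by lia.
    by apply: Classn3.
  have -> : (p == n.+1) = false by lia.
  have -> : (p == n.+2) = false by lia.
  by apply: Classn2.
have -> : (p == n) = false by lia.
have -> : (p == n.+1) = false by lia.
have -> : (p == n.+2) = false by lia.
by apply: Classn1.
Qed.

Lemma col_ok_e i a b w : 0 < i /\ i <= n ->
  col_ok a b -> we i [:: a; b] = Some w -> pair2 col_ok w.
Proof.
move=> hi /col_okP ok ew; have h4 : 4 <= n by lia.
have : pair2 (col_spec n) w.
  have [hin|hin] : (0 < i /\ i < n) \/ i = n by lia.
    by apply: (col_spec_e_lt h4 hin _ _ ok ew); apply: classP.
  by subst i; apply: (col_spec_en h4 _ _ ok ew); apply: classnP.
by case: w {ew} => [|? [|? []]] //= /col_okP.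
Qed.

Lemma cols_ok_e i a b c d w : 0 < i /\ i <= n ->
  cols_ok a b c d -> we i [:: a; b; c; d] = Some w -> quad cols_ok w.
Proof.
move=> hi /cols_okP ok ew; have h4 : 4 <= n by lia.
have : quad (cols_spec n) w.
  have [hin|hin] : (0 < i /\ i < n) \/ i = n by lia.
    by apply: (cols_spec_e_lt h4 hin _ _ _ _ ok ew); apply: classP.
  by subst i; apply: (cols_spec_en h4 _ _ _ _ ok ew); apply: classnP.
by case: w {ew} => [|? [|? [|? [|? []]]]] //= /cols_okP.
Qed.

Lemma col_ok_f i a b w : 0 < i /\ i <= n ->
  col_ok a b -> wf i [:: a; b] = Some w -> pair2 col_ok w.
Proof.
move=> hi /col_okP ok ew; have h4 : 4 <= n by lia.
have : pair2 (col_spec n) w.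
  have [hin|hin] : (0 < i /\ i < n) \/ i = n by lia.
    by apply: (col_spec_f_lt h4 hin _ _ ok ew); apply: classP.
  by subst i; apply: (col_spec_fn h4 _ _ ok ew); apply: classnP.
by case: w {ew} => [|? [|? []]] //= /col_okP.
Qed.

Lemma cols_ok_f i a b c d w : 0 < i /\ i <= n ->
  cols_ok a b c d -> wf i [:: a; b; c; d] = Some w -> quad cols_ok w.
Proof.
move=> hi /cols_okP ok ew; have h4 : 4 <= n by lia.
have : quad (cols_spec n) w.
  have [hin|hin] : (0 < i /\ i < n) \/ i = n by lia.
    by apply: (cols_spec_f_lt h4 hin _ _ _ _ ok ew); apply: classP.
  by subst i; apply: (cols_spec_fn h4 _ _ _ _ ok ew); apply: classnP.
by case: w {ew} => [|? [|? [|? [|? []]]]] //= /cols_okP.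
Qed.

Local Close Scope coq_nat_scope.

(** * Tableaux *)

(* The words of the component of u_k, see [in_BkE]. *)
Fixpoint ktab (w : seq nat) : bool :=
  match w with
  | [::] => true
  | a :: b :: w' =>
      match w' with
      | [::] => col_ok a b
      | c :: d :: _ => cols_ok a b c d
      | _ => false
      end && ktab w'
  | _ => false
  end.

Lemma ktab_ind (P : seq nat -> Prop) : P [::] ->
  (forall a b w, ktab [:: a, b & w] -> ktab w -> P w -> P [:: a, b & w]) ->
  forall w, ktab w -> P w.
Proof.
clear hn => P0 PS w; have [m] := ubnP (size w).
elim: m w => // m IH [//|a [//|b w]] hm hw.
have hw' : ktab w by case/andP: hw.
by apply: PS => //; apply: IH => //; move: hm => /=; lia.
Qed.

Lemma ktab_col a b w : ktab [:: a, b & w] -> col_ok a b.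
Proof. by case: w => [|c [|d w]] //=; [rewrite andbT | case/andP => /and5P[]]. Qed.

(* The operator applied to a word acts in the same way on every pair of adjacent
   columns that contains the modified letter. *)
Lemma ktab_e i w w' : 0 < i <= n -> ktab w -> we i w = Some w' -> ktab w'.
Proof.
move=> hi hw; have hi' : (0 < i)%coq_nat /\ (i <= n)%coq_nat by lia.
elim/ktab_ind: w / hw w' => // a b v habv hv IH w'.
have hab := ktab_col habv.
case: v habv hv IH => [_ _ _ ew|c [|d v]]; last first.
- move=> /andP[hc _] hv IH.
  rewrite -[[:: a, b, c, d & v]]/([:: a; b] ++ [:: c, d & v]) we_cat //.
  case: leqP => h.
    case eu: (we i [:: a; b]) => [u|//] [<-].
    have := col_ok_e hi' hab eu; case: u eu => [|a' [|b' []]] //= eu hab'.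
    have : weps i [:: c; d] <= wphi i [:: a; b].
      by move: h; rewrite -[[:: c, d & v]]/([:: c; d] ++ v) weps_cat //; clear; lia.
    move=> h2; move: hv => /= ->; rewrite andbT.
    apply: (cols_ok_e hi' hc (w := [:: a'; b'; c; d])).
    by rewrite -[[:: a; b; c; d]]/([:: a; b] ++ [:: c; d]) we_cat // h2 [we _ _]eu.
  case ev: (we i [:: c, d & v]) => [v'|//] [<-].
  have hv' := IH _ ev; move: ev h.
  rewrite -[[:: c, d & v]]/([:: c; d] ++ v) we_cat // weps_cat // => + h2.
  case: (leqP (weps i v) (wphi i [:: c; d])) => h.
    case eu: (we i [:: c; d]) => [u|//] [ev']; subst v'.
    have := col_ok_e hi' (ktab_col hv) eu; case: u eu hv' => [|c' [|d' []]] //= eu hv' _.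
    rewrite hv' andbT.
    apply: (cols_ok_e hi' hc (w := [:: a; b; c'; d'])).
    rewrite -[[:: a; b; c; d]]/([:: a; b] ++ [:: c; d]) we_cat //.
    have -> : weps i [:: c; d] <= wphi i [:: a; b] = false by clear -h2 h; lia.
    by rewrite [we _ [:: c; d]]eu.
  case ev: (we i v) => [v2|//] [ev']; subst v'.
  by move: hv' => /= ->; rewrite andbT.
- by case/andP.
by move/(col_ok_e hi' hab): ew; case: w' => [|a' [|b' []]] //= ->.
Qed.

Lemma ktab_f i w w' : 0 < i <= n -> ktab w -> wf i w = Some w' -> ktab w'.
Proof.
move=> hi hw; have hi' : (0 < i)%coq_nat /\ (i <= n)%coq_nat by lia.
elim/ktab_ind: w / hw w' => // a b v habv hv IH w'.
have hab := ktab_col habv.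
case: v habv hv IH => [_ _ _ ew|c [|d v]]; last first.
- move=> /andP[hc _] hv IH.
  rewrite -[[:: a, b, c, d & v]]/([:: a; b] ++ [:: c, d & v]) wf_cat //.
  case: ltnP => h.
    case eu: (wf i [:: a; b]) => [u|//] [<-].
    have := col_ok_f hi' hab eu; case: u eu => [|a' [|b' []]] //= eu hab'.
    have : weps i [:: c; d] < wphi i [:: a; b].
      by move: h; rewrite -[[:: c, d & v]]/([:: c; d] ++ v) weps_cat //; clear; lia.
    move=> h2; move: hv => /= ->; rewrite andbT.
    apply: (cols_ok_f hi' hc (w := [:: a'; b'; c; d])).
    by rewrite -[[:: a; b; c; d]]/([:: a; b] ++ [:: c; d]) wf_cat // h2 [wf _ _]eu.
  case ev: (wf i [:: c, d & v]) => [v'|//] [<-].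
  have hv' := IH _ ev; move: ev h.
  rewrite -[[:: c, d & v]]/([:: c; d] ++ v) wf_cat // weps_cat // => + h2.
  case: (ltnP (weps i v) (wphi i [:: c; d])) => h.
    case eu: (wf i [:: c; d]) => [u|//] [ev']; subst v'.
    have := col_ok_f hi' (ktab_col hv) eu; case: u eu hv' => [|c' [|d' []]] //= eu hv' _.
    rewrite hv' andbT.
    apply: (cols_ok_f hi' hc (w := [:: a; b; c'; d'])).
    rewrite -[[:: a; b; c; d]]/([:: a; b] ++ [:: c; d]) wf_cat //.
    have -> : weps i [:: c; d] < wphi i [:: a; b] = false by clear -h2 h; lia.
    by rewrite [wf _ [:: c; d]]eu.
  case ev: (wf i v) => [v2|//] [ev']; subst v'.
  by move: hv' => /= ->; rewrite andbT.
- by case/andP.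
by move/(col_ok_f hi' hab): ew; case: w' => [|a' [|b' []]] //= ->.
Qed.

(** * Words killed by e_1, ..., e_n, or by e_2, ..., e_n *)

Fixpoint blk (a b k : nat) : seq nat := if k is k'.+1 then [:: a, b & blk a b k'] else [::].

Lemma size_blk a b k : size (blk a b k) = k.*2.
Proof. by elim: k => //= k ->; rewrite doubleS. Qed.

Lemma blkSr a b k : blk a b k.+1 = blk a b k ++ [:: a; b].
Proof. by elim: k => //= k {1}->. Qed.

Lemma letter_hw p : 0 < p <= n + n -> (forall i, 0 < i <= n -> ~~ minus i p) -> p = 1.
Proof.
move=> hp h; apply/eqP; apply: contraT => hp1.
have [h1|h1] := leqP p n.
  by have := h p.-1; rewrite /letter_minus; lia.
have [h2|h2] := eqVneq p n.+1; first by have := h n; rewrite /letter_minus; lia.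
by have := h ((n + n).+1 - p); rewrite /letter_minus; lia.
Qed.

Lemma ktab_blk12 k : ktab (blk 1 2 k).
Proof.
elim: k => // -[|k] /= IH; last rewrite IH andbT.
  by rewrite /col_ok; lia.
by rewrite /cols_ok /col_ok /row_le; lia.
Qed.

Lemma ktab_12 w : ktab [:: 1, 2 & w] -> w = blk 1 2 (size w)./2.
Proof.
move=> hw; have : ktab w by case/andP: hw.
move=> h; elim/ktab_ind: w / h hw => // a b v h1 h2 IH.
move=> /andP[+ _]; have := ktab_col h1.
rewrite /cols_ok /row_le /col_ok => ha hb.
have ea : a = 1 by lia.
have eb : b = 2 by lia.
by subst a b; rewrite /= -IH.
Qed.

(** Only the first column read needs the hypothesis: its top letter has no incoming arrow, hence is
    1, and its bottom letter can only have an incoming 1-arrow, the one that f_1 leaves 1 by. The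
    row conditions then force every column to its left to be [1; 2]. *)
Lemma ktab_hw w : ktab w -> (forall i, 0 < i <= n -> weps i w = 0) -> w = blk 1 2 (size w)./2.
Proof.
case: w => // a [//|b w] hw he.
have hab := ktab_col hw.
have ea : a = 1.
  apply: letter_hw; first by case/and4P: hab.
  by move=> i /he /=; case: minus; lia.
have eb : b = 2.
  have he1 i : 0 < i <= n -> minus i b <= plus i a by move/he => /=; lia.
  subst a; case: (leqP b 2) => hb; first by move: hab; rewrite /col_ok; lia.
  case: (leqP b n) => h1; first by have := he1 b.-1; rewrite /letter_minus/letter_plus; lia.
  case: (eqVneq b n.+1) => h2; first by have := he1 n; rewrite /letter_minus /letter_plus; lia.
  by have := he1 ((n + n).+1 - b); move: hab; rewrite /col_ok /letter_minus /letter_plus; lia.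
subst a b; rewrite /=; congr [:: _, _ & _].
exact: ktab_12 hw.
Qed.

Definition bl (j : nat) : nat := (n + n).+1 - j.

Lemma sign1 :
  (((plus 1 1 = true) * (plus 1 2 = false) * (plus 1 3 = false) * (plus 1 4 = false)) *
  ((plus 1 (bl 1) = false) * (plus 1 (bl 2) = true) * (plus 1 (bl 3) = false)) *
  ((minus 1 1 = false) * (minus 1 2 = true) * (minus 1 3 = false) * (minus 1 4 = false)) *
  ((minus 1 (bl 1) = true) * (minus 1 (bl 2) = false) * (minus 1 (bl 3) = false)))%type.
Proof. by rewrite /letter_plus /letter_minus /bl; do !split; lia. Qed.

Lemma sign2 :
  (((plus 2 1 = false) * (plus 2 2 = true) * (plus 2 3 = false) * (plus 2 4 = false)) *
  ((plus 2 (bl 1) = false) * (plus 2 (bl 2) = false) * (plus 2 (bl 3) = true)) *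
  ((minus 2 1 = false) * (minus 2 2 = false) * (minus 2 3 = true) * (minus 2 4 = false)) *
  ((minus 2 (bl 1) = false) * (minus 2 (bl 2) = true) * (minus 2 (bl 3) = false)))%type.
Proof. by rewrite /letter_plus /letter_minus /bl; do !split; lia. Qed.

Lemma sign3 i : 2 < i ->
  (((plus i 1 = false) * (plus i 2 = false) *
  ((plus i (bl 1) = false) * (plus i (bl 2) = false)) *
  ((minus i 1 = false) * (minus i 2 = false)) *
  ((minus i (bl 1) = false) * (minus i (bl 2) = false))))%type.
Proof. by move=> hi; rewrite /letter_plus /letter_minus /bl; do !split; lia. Qed.

(** Under the indices 3, ..., n the vector representation splits into the fixed letters 1, 2, bar 2,
    bar 1 and a part whose only source is 3. *)
Lemma letter_hw3 p : 0 < p <= n + n -> (forall i, 2 < i <= n -> ~~ minus i p) ->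
  [\/ p <= 3, p = bl 2 | p = bl 1].
Proof.
move=> hp h; rewrite /bl.
have [h1|h1] := leqP p n.
  constructor 1; case: (leqP p 3) => // h2.
  by have := h p.-1; rewrite /letter_minus; lia.
have [h2|h2] := eqVneq p n.+1; first by have := h n; rewrite /letter_minus; lia.
have [h3|h3] := leqP (n + n).-1 p.
  have [h4|h4] := eqVneq p (n + n); first by constructor 3; lia.
  by constructor 2; lia.
by have := h ((n + n).+1 - p); rewrite /letter_minus; lia.
Qed.

Fixpoint jcols (w : seq nat) : bool :=
  match w with
  | [::] => true
  | x :: z :: v =>
      [&& (x == 1) || (x == 2), [|| z == 2, z == bl 2 | z == bl 1] & jcols v]
  | _ => false
  end.

Lemma ktab_tail a b w : ktab [:: a, b & w] -> ktab w.
Proof. by case/andP. Qed.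

Lemma ktab_next a b c d w : ktab [:: a, b, c, d & w] -> cols_ok a b c d.
Proof. by case/andP. Qed.

(** The maximum is needed for the column [bar n; n], whose codes decrease. *)
Lemma ktab_le a b w : ktab [:: a, b & w] -> all (leq^~ (maxn a b)) w.
Proof.
move=> hw; have h := ktab_tail hw.
elim/ktab_ind: w / h a b hw => // c d w h1 h2 IH a b hw.
have := ktab_next hw; rewrite /cols_ok /row_le => hc.
rewrite /=; apply/and3P; split; [lia|lia|].
by apply: sub_all (IH _ _ h1) => x /=; lia.
Qed.

Lemma count_mem_cons (p x : nat) v : count_mem p (x :: v) = (x == p) + count_mem p v.
Proof. by []. Qed.

(** Top entries stay at most 2 along the rows and are inert for i > 2, so each bottom entry is
    itself killed by these e_i; the equality of the two counts is the vanishing of the weight in the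
    direction delta_3. *)
Lemma jcolsP w : ktab w -> head 0 w <= 2 -> (forall i, 2 < i <= n -> weps i w = 0) ->
  count_mem 3 w = count_mem (bl 3) w -> jcols w.
Proof.
move=> h; elim/ktab_ind: w / h => // x z v h1 h2 IH hx he hc.
have hxz := ktab_col h1; rewrite /= in hx.
have hx' : (x == 1) || (x == 2) by move: hxz; rewrite /col_ok; lia.
have px i : 2 < i -> plus i x = false by move=> hi; case/orP: hx' => /eqP ->; rewrite sign3.
have mz : forall i, 2 < i <= n -> ~~ minus i z.
  by move=> i hi; have := he i hi; rewrite /= px; lia.
have hz : [|| z == 3, z == 2, z == bl 2 | z == bl 1].
  have hz0 : 0 < z <= n + n by case/and4P: hxz.
  by case: (letter_hw3 hz0 mz) => hz; move: hxz; rewrite /col_ok; lia.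
(* After a bottom entry 3 all letters are at most 3, so no bar 3 can balance it. *)
have [z3|z3] := eqVneq z 3.
  have := ktab_le h1; move: hc; rewrite !count_mem_cons z3 => hc /allP hv.
  suff : bl 3 \notin v by move/count_memPn; move: hc; rewrite /bl; lia.
  by apply/negP => /hv; rewrite /bl; lia.
rewrite (negPf z3) /= in hz.
rewrite /= hx' hz /=; apply: IH.
- case: v h1 {h2 he hc} => [|c [|d v]] //=.
  by case/andP; rewrite /cols_ok /row_le; lia.
- move=> i hi; have := he i hi; have hi' : 2 < i by lia.
  have pz : plus i z = false by case/or3P: hz => /eqP ->; rewrite sign3.
  by rewrite /= pz px //; lia.
- by move: hc; rewrite !count_mem_cons; move: hx' hz; rewrite /bl; lia.
Qed.

(** From left to right the tableau is [1; 2]^a [1; bar 2]^c [2; bar 2]^e [2; bar 1]^d. When c <= d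
    its parameters are k = d + e + c + a, lambda_1 = d + a - c, lambda_2 = 0 and w = c + a - d. *)
Definition jtab (d e c a : nat) : seq nat :=
  blk 2 (bl 1) d ++ blk 2 (bl 2) e ++ blk 1 (bl 2) c ++ blk 1 2 a.

(** The row conditions sort the columns; two adjacent columns [2; bar 2] are forbidden, whence e <=
    1. This bound makes the parameters determine the exponents. *)
Lemma jcols_form w : ktab w -> jcols w -> exists d e c a, w = jtab d e c a /\ e <= 1.
Proof.
move=> h; elim/ktab_ind: w / h => [|x z v h1 h2 IH].
  by exists 0, 0, 0, 0; split.
case/and3P=> hx hz /IH {IH} [d [e [c [a [ev he]]]]].
have hxz := ktab_col h1.
have nxt p q u : v = [:: p, q & u] -> cols_ok x z p q by move=> ev'; move: h1; rewrite ev' => /ktab_next.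
case/orP: hx => /eqP ex; subst x; case/or3P: hz => /eqP ez; subst z.
- have ed : d = 0.
    case: d ev => // d ev; have := nxt _ _ _ ev; rewrite /cols_ok /row_le; lia.
  subst d.
  have ee : e = 0.
    case: e ev {he} => // e ev; have := nxt _ _ _ ev; rewrite /cols_ok /row_le; lia.
  subst e.
  have ec : c = 0.
    case: c ev => // c ev; have := nxt _ _ _ ev; rewrite /cols_ok /row_le /bl; lia.
  by exists 0, 0, 0, a.+1; split; rewrite ?ev ?ec.
- have ed : d = 0.
    case: d ev => // d ev; have := nxt _ _ _ ev; rewrite /cols_ok /row_le; lia.
  subst d.
  have ee : e = 0.
    case: e ev {he} => // e ev; have := nxt _ _ _ ev; rewrite /cols_ok /row_le; lia.
  by exists 0, 0, c.+1, a; split; rewrite ?ev ?ee.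
- by move: hxz; rewrite /col_ok /bl; lia.
- by move: hxz; rewrite /col_ok /bl; lia.
- have ed : d = 0.
    case: d ev => // d ev; have := nxt _ _ _ ev; rewrite /cols_ok /row_le /bl; lia.
  subst d.
  have ee : e = 0.
    case: e ev {he} => // e ev; have := nxt _ _ _ ev; rewrite /cols_ok /row_le /bl; lia.
  by exists 0, 1, c, a; split; rewrite ?ev ?ee.
- by exists d.+1, e, c, a; split; rewrite ?ev.
Qed.

Lemma jhw_form w : ktab w -> (forall i, 2 <= i <= n -> weps i w = 0) ->
  count_mem 3 w = count_mem (bl 3) w -> exists d e c a, w = jtab d e c a /\ e <= 1.
Proof.
move=> hw he hc; apply: (jcols_form hw); apply: (jcolsP hw) => //; last first.
  by move=> i hi; apply: he; lia.
case: w hw he {hc} => [|x [|z v]] // hw he.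
have hxz := ktab_col hw.
have mx i : 2 <= i <= n -> ~~ minus i x by move=> /he /=; lia.
have hx0 : 0 < x <= n + n by case/and4P: hxz.
have mx3 : forall i, 2 < i <= n -> ~~ minus i x by move=> i hi; apply: mx; lia.
have := mx 2; have := hxz; rewrite /= /col_ok /letter_minus => h1 h2.
by case: (letter_hw3 hx0 mx3) => hx; move: hx; rewrite /bl; lia.
Qed.

Lemma blk_phi0 i a b k : wphi i [:: a; b] = 0 ->
  weps i (blk a b k) = k * weps i [:: a; b] /\ wphi i (blk a b k) = 0.
Proof.
move=> h; elim: k => // k [IH1 IH2].
rewrite -[blk a b k.+1]/([:: a; b] ++ blk a b k) weps_cat // wphi_cat // h IH1 IH2.
by split; lia.
Qed.

Lemma blk_eps0 i a b k : weps i [:: a; b] = 0 ->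
  weps i (blk a b k) = 0 /\ wphi i (blk a b k) = k * wphi i [:: a; b].
Proof.
move=> h; elim: k => // k [IH1 IH2].
rewrite -[blk a b k.+1]/([:: a; b] ++ blk a b k) weps_cat // wphi_cat // h IH1 IH2.
by split; lia.
Qed.

Lemma blk_one1 : ((forall k, weps 1 (blk 2 (bl 1) k) = k.*2) *
  (forall k, wphi 1 (blk 2 (bl 1) k) = 0) *
  (forall k, weps 1 (blk 1 (bl 2) k) = 0) *
  (forall k, wphi 1 (blk 1 (bl 2) k) = k.*2) *
  (forall k, weps 1 (blk 1 2 k) = 0) *
  (forall k, wphi 1 (blk 1 2 k) = 0))%type.
Proof.
do !split; move=> k.
- by rewrite (blk_phi0 _ _).1 /= ?sign1 //; lia.
- by rewrite (blk_phi0 _ _).2 /= ?sign1.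
- by rewrite (blk_eps0 _ _).1 /= ?sign1.
- by rewrite (blk_eps0 _ _).2 /= ?sign1 //; lia.
- by rewrite (blk_eps0 _ _).1 /= ?sign1.
- by rewrite (blk_eps0 _ _).2 /= ?sign1 //; lia.
Qed.

Lemma blk_two : ((forall k, weps 2 (blk 2 (bl 1) k) = 0) *
  (forall k, wphi 2 (blk 2 (bl 1) k) = k) *
  (forall k, weps 2 (blk 2 (bl 2) k) = 0) *
  (forall k, wphi 2 (blk 2 (bl 2) k) = 0) *
  (forall k, weps 2 (blk 1 (bl 2) k) = k) *
  (forall k, wphi 2 (blk 1 (bl 2) k) = 0) *
  (forall k, weps 2 (blk 1 2 k) = 0) *
  (forall k, wphi 2 (blk 1 2 k) = k))%type.
Proof.
do !split; move=> k.
- by rewrite (blk_eps0 _ _).1 /= ?sign2.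
- by rewrite (blk_eps0 _ _).2 /= ?sign2 //; lia.
- by rewrite (blk_eps0 _ _).1 /= ?sign2.
- by rewrite (blk_eps0 _ _).2 /= ?sign2 //; lia.
- by rewrite (blk_phi0 _ _).1 /= ?sign2 //; lia.
- by rewrite (blk_phi0 _ _).2 /= ?sign2 //; lia.
- by rewrite (blk_eps0 _ _).1 /= ?sign2.
- by rewrite (blk_eps0 _ _).2 /= ?sign2 //; lia.
Qed.

Lemma blk_three i : 2 < i -> ((forall k, weps i (blk 2 (bl 1) k) = 0) *
  (forall k, wphi i (blk 2 (bl 1) k) = 0) *
  (forall k, weps i (blk 2 (bl 2) k) = 0) *
  (forall k, wphi i (blk 2 (bl 2) k) = 0) *
  (forall k, weps i (blk 1 (bl 2) k) = 0) *
  (forall k, wphi i (blk 1 (bl 2) k) = 0) *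
  (forall k, weps i (blk 1 2 k) = 0) *
  (forall k, wphi i (blk 1 2 k) = 0))%type.
Proof.
move=> hi.
by do !split; move=> k; rewrite ?(blk_eps0 _ _).1 ?(blk_eps0 _ _).2 /= ?sign3 //; lia.
Qed.

Lemma eps1_jtab d e c a : e <= 1 -> weps 1 (jtab d e c a) = d.*2 + e.
Proof.
move=> he; rewrite /jtab !(weps_cat, wphi_cat) // !blk_one1.
by case: e he => [|[|e]] he //=; rewrite ?sign1 /=; lia.
Qed.

Lemma phi1_jtab d e c a : e <= 1 -> wphi 1 (jtab d e c a) = c.*2 + e.
Proof.
move=> he; rewrite /jtab !(weps_cat, wphi_cat) // !blk_one1.
by case: e he => [|[|e]] he //=; rewrite ?sign1 /=; lia.
Qed.

(** Each column [1; bar 2] has eps_2 = 1 and is cancelled by one of the columns [2; bar 1], read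
    earlier, with phi_2 = 1. *)
Lemma epsJ_jtab i d e c a : c <= d -> 2 <= i -> weps i (jtab d e c a) = 0.
Proof.
move=> hcd hi; rewrite /jtab !(weps_cat, wphi_cat) //.
have [->|hi'] := eqVneq i 2; first by rewrite !blk_two; lia.
have h3 : 2 < i by lia.
by rewrite !(blk_three h3); lia.
Qed.

Lemma e1_jtab1 d c : we 1 (jtab d 1 c 0) = Some (jtab d 0 c.+1 0).
Proof.
rewrite /jtab /= cats0 we_cat // blk_one1.
rewrite -[[:: 2, bl 2 & blk 1 (bl 2) c]]/([:: 2; bl 2] ++ blk 1 (bl 2) c).
rewrite weps_cat // we_cat // !blk_one1 /= !sign1 /=.
by rewrite /letter_jump (_ : (1 == n) = false) //; lia.
Qed.

Lemma e1_jtab0 d c : we 1 (jtab d.+1 0 c 0) = Some (jtab d 1 c 0).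
Proof.
rewrite /jtab [blk 2 (bl 2) 0]/= [blk 1 2 0]/= cat0s cats0 blkSr -catA we_cat // weps_cat // !blk_one1 we_cat // blk_one1 /= !sign1 /=.
rewrite /letter_jump (_ : (1 == n) = false) /=; last lia.
by rewrite (_ : bl 1 - 1 = bl 2) // /bl; lia.
Qed.

Lemma f2_jtab d e c a : c <= d ->
  wf 2 (jtab d.+1 e c a) = Some [:: 3, bl 1 & jtab d e c a].
Proof.
move=> hcd; rewrite -[jtab d.+1 _ _ _]/([:: 2; bl 1] ++ jtab d e c a) wf_cat //.
rewrite epsJ_jtab //= !sign2 /= /letter_jump.
by rewrite (_ : (2 == n) = false) //; lia.
Qed.

Lemma size_jtab d e c a : size (jtab d e c a) = (d + e + c + a).*2.
Proof. by clear hn; rewrite /jtab !size_cat !size_blk; lia. Qed.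

Lemma count_blk (p a b k : nat) : count_mem p (blk a b k) = k * ((a == p) + (b == p)).
Proof. by clear hn; elim: k => //= k ->; lia. Qed.

(** * From letters, tableaux and crystals to codes and words *)

Definition lpos (x : letter n) : nat := if x.2 then bl x.1.+1 else x.1.+1.
Definition lblp (p : nat) : label := if p <= n then pos p else bar (bl p).

Lemma lblpK x : lblp (lpos x) = lab x.
Proof.
case: x => j b; rewrite /lblp /lpos /lab /bl /=; have := ltn_ord j.
case: b => hj; last by rewrite hj.
rewrite (_ : _ <= n = false); last by apply/negbTE; lia.
by rewrite /bar; congr pair; lia.
Qed.

Lemma lpos_bound x : 0 < lpos x <= n + n.
Proof. by case: x => j b; rewrite /lpos /bl /=; have := ltn_ord j; case: b; lia. Qed.

Lemma lpos_ex p : 0 < p <= n + n -> exists x, lpos x = p.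
Proof.
move=> hp; case: (leqP p n) => h.
  have h1 : p.-1 < n by lia.
  by exists (Ordinal h1, false); rewrite /lpos /=; lia.
have h1 : n + n - p < n by lia.
by exists (Ordinal h1, true); rewrite /lpos /bl /=; lia.
Qed.

Lemma lpos_inj : injective lpos.
Proof.
move=> [i a] [j b] e; have := congr1 lblp e; rewrite !lblpK /lab /= => -[].
by move=> /val_inj -> ->.
Qed.

Lemma label_arrowE i (x y : letter n) :
  label_arrow n i (lab x) (lab y) = plus i (lpos x) && (lpos y == lpos x + jump i).
Proof.
case: x y => [x a] [y b]; have := ltn_ord x; have := ltn_ord y.
rewrite /label_arrow /lab /lpos /pos /bar /bl /letter_plus /letter_jump /= => hy hx.
rewrite !xpair_eqE.
by case: a; case: b; rewrite ?andbT ?andbF ?orbF /=; case: ifP => ?; case: ifP => ?; lia.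
Qed.

Lemma ff_letter i (x : letter_crystal n) :
  omap lpos (ff i x) = if plus i (lpos x) then Some (lpos x + jump i) else None.
Proof.
rewrite /=; case: pickP => [y|h].
  by rewrite label_arrowE => /andP[-> /eqP <-].
case: ifP => // hx.
have [y hy] : exists y, lpos y = lpos x + jump i.
  apply: lpos_ex; move: hx (lpos_bound x); rewrite /letter_plus /letter_jump; case: ifP; lia.
by have := h y; rewrite label_arrowE hx hy eqxx.
Qed.

Lemma ee_letter i (x : letter_crystal n) :
  omap lpos (ee i x) = if minus i (lpos x) then Some (lpos x - jump i) else None.
Proof.
rewrite /=; case: pickP => [y|h].
  rewrite label_arrowE => /andP[hp /eqP ->].
  by rewrite plus_jump //= addnK.
case: ifP => // hx; have [hp hj] := minus_jump hx.
have [y hy] : exists y, lpos y = lpos x - jump i.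
  apply: lpos_ex; move: hx (lpos_bound x); rewrite /letter_minus /letter_jump; case: ifP; lia.
by have := h y; rewrite label_arrowE hy hp subnK // eqxx.
Qed.

Lemma phi_letter i (x : letter_crystal n) : phi i x = plus i (lpos x).
Proof.
pose g' p := if plus i p then Some (p + jump i) else None.
apply: (depth_model (g' := g') (m := fun p => plus i p : nat)) (ff_letter i) _ _ x.
  move=> p p'; rewrite /g'; case: ifP => // hp [<-].
  by have /(minus_plusF) -> := plus_jump hp.
by move=> p; rewrite /g'; case: ifP.
Qed.

Fixpoint wpos (m : nat) : tpow (letter_crystal n) m -> seq nat :=
  if m is m'.+1 then fun w : letter n * tpow (letter_crystal n) m' => lpos w.1 :: wpos w.2
  else fun=> [::].

Lemma eps_model (T : finType) (g : T -> option T) (h : T -> seq nat) i :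
  (forall b, omap h (g b) = we i (h b)) -> forall b, depth g b = weps i (h b).
Proof.
move=> gh b; apply: (depth_model gh).
  by move=> x x' /(we_Some)[].
by move=> x /eqP; rewrite we_None // => /eqP.
Qed.

Lemma phi_model (T : finType) (g : T -> option T) (h : T -> seq nat) i :
  (forall b, omap h (g b) = wf i (h b)) -> forall b, depth g b = wphi i (h b).
Proof.
move=> gh b; apply: (depth_model gh).
  by move=> x x' /(wf_Some) /(we_Some)[].
by move=> x /eqP; rewrite wf_None // => /eqP.
Qed.

Lemma ee_tens (B1 B2 : crystal n) i (b1 : B1) (b2 : B2) :
  ee i ((b1, b2) : tens B1 B2) = if eps i b2 <= phi i b1
    then omap (fun x => (x, b2)) (ee i b1) else omap (fun y => (b1, y)) (ee i b2).
Proof. by []. Qed.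

Lemma ff_tens (B1 B2 : crystal n) i (b1 : B1) (b2 : B2) :
  ff i ((b1, b2) : tens B1 B2) = if eps i b2 < phi i b1
    then omap (fun x => (x, b2)) (ff i b1) else omap (fun y => (b1, y)) (ff i b2).
Proof. by []. Qed.

Lemma word_ops i m : (forall w : tpow (letter_crystal n) m, omap (@wpos m) (ee i w) = we i (wpos w)) /\
  (forall w : tpow (letter_crystal n) m, omap (@wpos m) (ff i w) = wf i (wpos w)).
Proof.
elim: m => // m [IHe IHf].
have eE (w : tpow (letter_crystal n) m) : eps i w = weps i (wpos w).
  exact: eps_model IHe w.
have fE (w : tpow (letter_crystal n) m) : phi i w = wphi i (wpos w).
  exact: phi_model IHf w.
split=> -[x w].
  rewrite ee_tens eE phi_letter [wpos _]/= [we _ _]/=.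
  case: ifP => _.
    by have := ee_letter i x; case: (ee i x) => [y|]; case: ifP => //= _ [->].
  by have := IHe w; case: (ee i w) => [y|] /= <-.
rewrite ff_tens eE phi_letter [wpos _]/= [wf _ _]/=.
case: ifP => hlt.
  have := ff_letter i x; case: (ff i x) => [y|]; case: ifP => //=; first by move=> _ [->].
  by move=> h; rewrite h in hlt.
by have := IHf w; case: (ff i w) => [y|] /= <-.
Qed.

Lemma wpos_inj m : injective (@wpos m).
Proof.
elim: m => [|m IH] /=; first by move=> [] [].
by move=> [x w] [y v] /= [/lpos_inj -> /IH ->].
Qed.

Lemma wpos_ex m w : size w = m -> all (fun p => 0 < p <= n + n) w ->
  exists x : tpow (letter_crystal n) m, wpos x = w.
Proof.
elim: m w => [|m IH] [|p w] //=.
move=> [/IH {}IH] /andP[/lpos_ex[x hx] /IH[v hv]].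
by exists (x, v); rewrite /= hx hv.
Qed.

Lemma size_wpos m (w : tpow (letter_crystal n) m) : size (wpos w) = m.
Proof. by elim: m w => //= m IH w; rewrite IH. Qed.

Lemma utabS k : utab k.+1 = rcons (utab k) (column (pos 1) (pos 2)).
Proof. by elim: k => //= k <-. Qed.

Fixpoint tabp (w : seq nat) : tableau :=
  if w is a :: b :: w' then rcons (tabp w') (lblp a, lblp b) else [::].

Lemma tab_of_wordE k (w : word n k) : tab_of_word w = tabp (wpos w).
Proof.
elim: k w => // k IH [x [y w]].
by rewrite /= !lblpK -IH.
Qed.

Lemma tabp_blk k : tabp (blk 1 2 k) = utab k.
Proof.
have h1 : 1 <= n by lia.
have h2 : 2 <= n by lia.
by elim: k => //= k ->; rewrite /lblp h1 h2 -utabS.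
Qed.

(** With [posw], this recovers the word from the tableau, so that [utab k] is the tableau of one
    word only. *)
Definition plab (l : label) : nat := if l.2 then bl l.1 else l.1.
Definition posw (t : tableau) : seq nat :=
  foldl (fun acc c => [:: plab c.1, plab c.2 & acc]) [::] t.

Lemma posw_tab k (w : word n k) : posw (tab_of_word w) = wpos w.
Proof.
elim: k w => // k IH [x [y w]].
by rewrite /= /posw foldl_rcons -/(posw _) IH.
Qed.

Lemma posw_utab k : posw (utab k) = blk 1 2 k.
Proof.
elim: k => // k IH; by rewrite utabS /posw foldl_rcons -/(posw _) IH.
Qed.

Lemma all_ktab w : ktab w -> all (fun p => 0 < p <= n + n) w.
Proof.
move=> h; elim/ktab_ind: w / h => // a b w /ktab_col hab _ /= ->.
by case/and4P: hab => -> ->.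
Qed.

Lemma in_BkE k (x : word n k) : in_BkLambda2 x = ktab (wpos x).
Proof.
apply/idP/idP.
  case/existsP=> y /andP[/eqP hy /connectP[p]].
  have : ktab (wpos y) by rewrite -posw_tab hy posw_utab; apply: ktab_blk12.
  elim: p y {hy} => [|z p IH] y ky /=; first by move=> _ ->.
  case/andP=> /hasP[i]; rewrite mem_iota => hi hyz hp hx.
  apply: IH hp hx.
  have [we wf] := word_ops i k.*2.
  have hi' : 0 < i <= n by lia.
  case/orP: hyz => /eqP hyz.
    by apply: (ktab_e hi' ky); rewrite -we hyz.
  by apply: (ktab_f hi' ky); rewrite -wf hyz.
(* Conversely, climb by the e_i until the word is u_k; this ends because every e_i lowers the sum of
   the codes. *)
move: {2}(sumn (wpos x)).+1 (ltnSn (sumn (wpos x))) => N.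
elim: N x => // N IH x hN kx.
case: (boolP [forall i : 'I_n, weps i.+1 (wpos x) == 0]) => [/forallP h|].
  have hx : wpos x = blk 1 2 k.
    rewrite (ktab_hw kx) ?size_wpos ?doubleK // => i hi.
    have hi1 : i.-1 < n by lia.
    by have := h (Ordinal hi1); rewrite /= prednK; [move/eqP|lia].
  apply/existsP; exists x.
  by rewrite tab_of_wordE hx tabp_blk eqxx connect0.
rewrite negb_forall => /existsP[i]; have [we wf] := word_ops i.+1 k.*2.
have := we x; case ex: (ee _ x) => [x'|] /=; last first.
  by move/esym/eqP; rewrite we_None // => ->.
move=> /esym hx' _.
have [hf _ _] := we_Some hx'.
have kx' : ktab (wpos x') by apply: (ktab_e _ kx hx'); have := ltn_ord i; lia.
have hlt : sumn (wpos x') < sumn (wpos x).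
  move: hx'; clear -hn; elim: (wpos x) (wpos x') => // p u IHu v /=.
  case: ifP => _.
    case: ifP => // hm [<-] /=; have [hp hj] := minus_jump hm.
    by move: hj hm; rewrite /letter_jump /letter_minus; case: ifP; lia.
  by case E: (we _ u) => [u'|] //= [<-] /=; have := IHu _ E; lia.
have /existsP[y /andP[hy hc]] : in_BkLambda2 x' by apply: IH => //; lia.
apply/existsP; exists y; rewrite hy; apply: (connect_trans hc).
apply: connect1; apply/hasP; exists i.+1; first by rewrite mem_iota; have := ltn_ord i; lia.
apply/orP; right; have := wf x'; rewrite hf.
by case: (ff _ x') => [z|] //= [/wpos_inj ->].
Qed.

Lemma wt_word m (w : tpow (letter_crystal n) m) (j : 'I_n) :
  wt w ord0 j = ((count_mem j.+1 (wpos w))%:Z - (count_mem (bl j.+1) (wpos w))%:Z)%R.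
Proof.
elim: m w => [|m IH] w; first by rewrite mxE.
rewrite [wt w]/= mxE IH; case: w => -[i e] w; rewrite /lpos /=.
have := ltn_ord i; have := ltn_ord j => hj hi.
case: e; rewrite !mxE.
  have -> : (bl i.+1 == j.+1) = false by rewrite /bl; lia.
  have -> : (bl i.+1 == bl j.+1) = (j.+1 == i.+1) by rewrite /bl; lia.
  by case: (_ == _); lia.
have -> : (i.+1 == bl j.+1) = false by rewrite /bl; lia.
by rewrite eq_sym; case: (_ == _); lia.
Qed.

Section B2c.
Variable s : nat.

Definition pw (b : B2_classical n s) : seq nat := wpos (val (tagged b)).

Lemma pw_ktab b : ktab (pw b).
Proof. by rewrite /pw -in_BkE; apply: valP. Qed.

Lemma size_pw b : size (pw b) = (tag b).*2.
Proof. exact: size_wpos. Qed.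

(** The length of the word determines the component k. *)
Lemma pw_inj : injective pw.
Proof.
move=> [k x] [l y] e.
have ekl : k = l.
  have := congr1 size e; rewrite !size_pw /= => /double_inj; exact: val_inj.
subst l; congr existT; apply: val_inj; exact: wpos_inj.
Qed.

Lemma pw_ex w : ktab w -> size w <= s.*2 -> exists b, pw b = w.
Proof.
move=> kw hw.
have sw : ~~ odd (size w) by elim/ktab_ind: w / kw {hw} => //= a b w _ _ ->.
have hk : (size w)./2 < s.+1 by rewrite ltnS -leq_double even_halfK.
have [x hx] : exists x : word n (Ordinal hk), wpos x = w.
  by apply: wpos_ex; [rewrite /= even_halfK | apply: all_ktab].
have px : in_BkLambda2 x by rewrite in_BkE hx.
by exists (Tagged (fun k : 'I_s.+1 => BkLambda2 n k) (exist _ x px)).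
Qed.

Lemma pw_tab b : tab b = tabp (pw b).
Proof. exact: tab_of_wordE. Qed.

Lemma pw_e i b : 0 < i <= n -> omap pw (ee i b) = we i (pw b).
Proof.
case: b => k [x px] hi; rewrite /pw /=.
have [we _] := word_ops i k.*2; have := we x.
case ex: (ee i x) => [x'|] /= <- //.
have px' : in_BkLambda2 x'.
  by rewrite in_BkE (ktab_e hi (w := wpos x)) -?in_BkE // -we ex.
by rewrite insubT.
Qed.

Lemma pw_f i b : 0 < i <= n -> omap pw (ff i b) = wf i (pw b).
Proof.
case: b => k [x px] hi; rewrite /pw /=.
have [_ wf] := word_ops i k.*2; have := wf x.
case ex: (ff i x) => [x'|] /= <- //.
have px' : in_BkLambda2 x'.
  by rewrite in_BkE (ktab_f hi (w := wpos x)) -?in_BkE // -wf ex.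
by rewrite insubT.
Qed.

Lemma wt_pw b (j : 'I_n) :
  wt b ord0 j = ((count_mem j.+1 (pw b))%:Z - (count_mem (bl j.+1) (pw b))%:Z)%R.
Proof. exact: wt_word. Qed.

End B2c.

(** * The involution sigma *)

Section Sigma.
Variable s : nat.
Variable sigma : B2_classical n s -> B2_classical n s.
Hypothesis hsigma : is_sigma sigma.

Lemma count_jtab p d e c a : count_mem p (jtab d e c a) =
  d * ((2 == p) + (bl 1 == p)) + e * ((2 == p) + (bl 2 == p)) +
  c * ((1 == p) + (bl 2 == p)) + a * ((1 == p) + (2 == p)).
Proof. by rewrite /jtab !count_cat !count_blk !addnA. Qed.

Lemma coef_jtab p d e c a : 0 < p <= n ->
  ((count_mem p (jtab d e c a))%:Z - (count_mem (bl p) (jtab d e c a))%:Z =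
   (((c + a)%:Z - d%:Z) * (p == 1)%:Z + ((d + a)%:Z - c%:Z) * (p == 2)%:Z))%R.
Proof.
move=> hp; rewrite !count_jtab.
have [-> ->] : (bl 1 == p) = false /\ (bl 2 == p) = false by rewrite /bl; split; lia.
have [-> ->] : (1 == bl p) = false /\ (2 == bl p) = false by rewrite /bl; split; lia.
have [-> ->] : (bl 1 == bl p) = (p == 1) /\ (bl 2 == bl p) = (p == 2) by rewrite /bl; split; lia.
rewrite ![_ == p]eq_sym; have [->|h1] := eqVneq p 1; first by rewrite /=; clear; lia.
by case: eqP => _; rewrite /=; clear; lia.
Qed.

Lemma jtab_params (b : B2_classical n s) d e c a : c <= d -> pw b = jtab d e c a ->
  has_params b (d + e + c + a) (d + a - c) 0 ((c + a)%:Z - d%:Z)%R.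
Proof.
move=> hcd hb; split.
- move=> i hi; have hi' : 0 < i <= n by lia.
  have : we i (pw b) == None by rewrite we_None // hb epsJ_jtab //; lia.
  by rewrite -pw_e //; case: (ee i b).
- by have := size_pw b; rewrite hb size_jtab => /double_inj ->.
apply/rowP => j; rewrite wt_pw // hb coef_jtab; last by have := ltn_ord j; lia.
by rewrite !mxE mul0r addr0 !natz -subzn //; lia.
Qed.

Lemma params_jtab (b : B2_classical n s) k l1 w : has_params b k l1 0 w ->
  exists d e c a, [/\ pw b = jtab d e c a, e <= 1, d + e + c + a = k,
    l1 + c = d + a & w = ((c + a)%:Z - d%:Z)%R].
Proof.
case=> he hk hw.
have cw (j : 'I_n) : ((count_mem j.+1 (pw b))%:Z - (count_mem (bl j.+1) (pw b))%:Z =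
    w * (j.+1 == 1)%:Z + l1%:Z * (j.+1 == 2)%:Z)%R.
  by rewrite -wt_pw // hw !mxE mul0r addr0 !natz.
have h1 : 0 < n by lia.
have h2 : 1 < n by lia.
have h3 : 2 < n by lia.
have [d [e [c [a [hb he1]]]]] : exists d e c a, pw b = jtab d e c a /\ e <= 1.
  apply: jhw_form; [exact: pw_ktab | |].
    move=> i hi; apply/eqP; rewrite -we_None // -pw_e //; last lia.
    by rewrite he.
  by have := cw (Ordinal h3); rewrite /=; clear; lia.
exists d, e, c, a.
have := cw (Ordinal h1); have := cw (Ordinal h2).
rewrite hb /= !coef_jtab; try lia.
have := size_pw b; rewrite hk hb size_jtab => /double_inj <- /=.
by clear -he1 => c2 c1; split=> //; lia.
Qed.

(** The identity k - lambda_1 = e + 2c holds before and after sigma, which replaces this number by s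
    - k: the new e and c are the parity and the half of m. As 2a = lambda_1 + w and 2(d - c) =
    lambda_1 - w, changing the sign of w exchanges a and d - c. *)
Lemma sigma_jtab (b : B2_classical n s) d e c a : c <= d -> pw b = jtab d e c a ->
  let m := s - (d + e + c + a) in
  pw (sigma b) = jtab (m./2 + a) (odd m) m./2 (d - c).
Proof.
move=> hcd hb; have [_ _ hp] := hsigma.
have hk : d + e + c + a <= s.
  by have := size_pw b; rewrite hb size_jtab => /double_inj ->; have := ltn_ord (tag b).
have /params_jtab[d' [e' [c' [a' [-> he hs hl hw]]]]] := hp _ _ _ _ _ (jtab_params hcd hb).
move=> m.
have ea : a' = d - c by lia.
have ed : d' = c' + a by lia.
have em : m = e' + c'.*2 by rewrite /m; lia.
have -> : odd m = e' :> nat by rewrite em; lia.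
have -> : m./2 = c' by rewrite em; lia.
by rewrite ea ed.
Qed.

Definition srel (w z : seq nat) : Prop := exists2 b, pw b = w & pw (sigma b) = z.

Lemma srel_sym w z : srel w z -> srel z w.
Proof. by case: hsigma => hi _ _ [b hw hz]; exists (sigma b); rewrite ?hi. Qed.

Lemma srel_pw w z b : srel w z -> pw b = w -> pw (sigma b) = z.
Proof. by case=> b' <- <- /pw_inj ->. Qed.

Lemma srel_f i w z w' z' : 2 <= i <= n -> srel w z ->
  wf i w = Some w' -> wf i z = Some z' -> srel w' z'.
Proof.
case: hsigma => _ hJ _ hi [b <- <-].
have hi' : 0 < i <= n by lia.
have [_ hf] := hJ i hi b.
rewrite -!pw_f // hf; case: (ff i b) => [b'|] //= [<-] [<-]; by exists b'.
Qed.

Lemma srel_jtab d e c a : c <= d -> d + e + c + a <= s -> ktab (jtab d e c a) ->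
  let m := s - (d + e + c + a) in
  srel (jtab d e c a) (jtab (m./2 + a) (odd m) m./2 (d - c)).
Proof.
move=> hcd hk kt m.
have [b hb] : exists b : B2_classical n s, pw b = jtab d e c a.
  by apply: pw_ex => //; rewrite size_jtab leq_double.
by exists b => //; apply: sigma_jtab.
Qed.

Lemma srel_u k : k <= s -> srel (blk 1 2 k) (jtab ((s - k)./2 + k) (odd (s - k)) (s - k)./2 0).
Proof. by move=> hk; apply: (srel_jtab (d := 0) (e := 0) (c := 0)) => //; apply: ktab_blk12. Qed.

(** For m = s - k - 1 the two words are the sigma-images of u_{k+1} and u_k, whence e_0 u_{k+1} =
    u_k. If m is even, e_1 turns a column [2; bar 1] into [2; bar 2]; if m is odd, it turns
    [2; bar 2] into [1; bar 2]. *)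
Lemma e1_u m k : we 1 (jtab (m./2 + k.+1) (odd m) m./2 0) =
  Some (jtab ((m.+1)./2 + k) (odd m.+1) (m.+1)./2 0).
Proof.
have -> : odd m.+1 = ~~ odd m by [].
rewrite addnS -uphalfE uphalf_half; case: (odd m); last first.
  by rewrite -[nat_of_bool false]/0 -[nat_of_bool (~~ _)]/1 add0n e1_jtab0.
by rewrite -[nat_of_bool true]/1 -[nat_of_bool (~~ _)]/0 e1_jtab1 // add1n addSn.
Qed.

(* One step of the vector representation of D_{n-1} carries the letters from
   [m] to its bar. *)
Lemma letter_chain (P : nat -> Prop) m : 2 <= m < n -> P m ->
  (forall i p, m <= i <= n -> plus i p -> P p -> P (p + jump i)) ->
  forall p, m <= p <= bl m -> P p.
Proof.
move=> hm Pm step p; have [N] := ubnP p; elim: N p => // N IH p hN hp.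
have [-> //|hpm] := eqVneq p m.
have [hpn|hpn] := leqP p n.
  have := step p.-1 p.-1; rewrite /letter_jump ifF ?addn1 ?prednK; try lia.
  by apply; [lia | rewrite /letter_plus; lia | apply: IH; lia].
have [e|hpn1] := eqVneq p n.+1.
  have := step n n.-1; rewrite /letter_jump eqxx (_ : n.-1 + 2 = p); last lia.
  by apply; [lia | rewrite /letter_plus; lia | apply: IH; lia].
have := step (bl p) p.-1; move: hp; rewrite /letter_jump /bl => hp.
rewrite ifF ?addn1 ?prednK; try lia.
by apply; [lia | rewrite /letter_plus; lia | apply: IH; rewrite /bl; lia].
Qed.

Lemma wf_mid i P y Q : wphi i P = 0 -> weps i Q = 0 -> plus i y ->
  wf i (P ++ y :: Q) = Some (P ++ y + jump i :: Q).
Proof. by move=> hP hQ hy; rewrite wf_cat // hP /= hQ hy. Qed.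

(** The surroundings are neutral for the indices used, so each f_i acts on the displayed letter in
    both words, and sigma commutes with it. *)
Lemma srel_chain m P Q P' Q' : 2 <= m < n ->
  (forall i, m <= i <= n -> wphi i P = 0 /\ weps i Q = 0) ->
  (forall i, m <= i <= n -> wphi i P' = 0 /\ weps i Q' = 0) ->
  srel (P ++ m :: Q) (P' ++ m :: Q') ->
  forall y, m <= y <= bl m -> srel (P ++ y :: Q) (P' ++ y :: Q').
Proof.
move=> hm h h' h0; apply: (letter_chain hm h0) => i p hi hp hs.
have [h1 h2] := h i hi; have [h3 h4] := h' i hi.
have hi' : 2 <= i <= n by lia.
by apply: (srel_f hi' hs); apply: wf_mid.
Qed.

(** For y = bar 2 the left word is the right factor of the image in case (3). The chain starts at y
    = 2, where the word is a [jtab] with d = 1. *)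
Lemma srel_T3 j y : j + 2 <= s -> 2 <= y <= bl 2 -> let m := s - (j + 2) in
  srel [:: y, bl 1 & blk 1 2 j.+1] [:: y, bl 1 & jtab (m./2 + j) (odd m) m./2 1].
Proof.
move=> hj hy m.
have h1 : 2 <= 2 < n by lia.
have e1 i Q : 2 <= i <= n -> weps i (bl 1 :: Q) = weps i Q.
  move=> hi; have [->|hi2] := eqVneq i 2; first by rewrite /= !sign2 // subn0.
  by rewrite /= !sign3 // ?subn0 //; lia.
apply: (@srel_chain 2 [::] _ [::] _ h1 _ _ _ y hy).
- move=> i hi; split=> //; rewrite e1 // -[blk 1 2 j.+1]/(jtab 0 0 0 j.+1).
  by rewrite epsJ_jtab //; lia.
- by move=> i hi; split=> //; rewrite e1 // epsJ_jtab //; lia.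
rewrite !cat0s.
have h := @srel_jtab 1 0 0 j.+1 isT; cbv zeta in h.
rewrite (_ : 1 + 0 + 0 + j.+1 = j + 2) -/m ?(addnS m./2) in h; last lia.
apply: h => //.
apply/andP; split; last exact: (ktab_blk12 j.+1).
by rewrite /cols_ok /col_ok /row_le /bl; lia.
Qed.

(** Apply f_2 to u_{k+1} and to its sigma-image: in both it changes the first 2 read into 3. *)
Lemma srel_13 k : k < s -> let m := s - k.+1 in
  srel [:: 1, 3 & blk 1 2 k] [:: 3, bl 1 & jtab (m./2 + k) (odd m) m./2 0].
Proof.
move=> hk m; have h2 : 2 <= 2 <= n by lia.
apply: (srel_f h2 (srel_u hk)).
  rewrite -[blk 1 2 k.+1]/([:: 1; 2] ++ blk 1 2 k) wf_cat // blk_two //= !sign2 //=.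
  by rewrite /letter_jump (_ : (2 == n) = false) //; lia.
by rewrite addnS f2_jtab // leq_addr.
Qed.

Local Notation B := (B2 sigma).

Lemma eps0_srel w z (b : B) : srel w z -> pw b = w -> eps 0 b = weps 1 z.
Proof.
case: (hsigma) => inv _ _ hr /(srel_pw hr) <-.
apply: (eps_model (h := fun b : B => pw (sigma b))) b => b.
rewrite -pw_e //; last lia.
rewrite -[ee 0 b]/(omap sigma (ee 1 (sigma b))).
by case: (ee 1 (sigma b)) => [b'|] //=; rewrite inv.
Qed.

Lemma phi0_srel w z (b : B) : srel w z -> pw b = w -> phi 0 b = wphi 1 z.
Proof.
case: (hsigma) => inv _ _ hr /(srel_pw hr) <-.
apply: (phi_model (h := fun b : B => pw (sigma b))) b => b.
rewrite -pw_f //; last lia.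
rewrite -[ff 0 b]/(omap sigma (ff 1 (sigma b))).
by case: (ff 1 (sigma b)) => [b'|] //=; rewrite inv.
Qed.

Lemma e0_srel w z w' z' (b : B) : srel w z -> we 1 z = Some z' -> srel w' z' ->
  pw b = w -> exists2 b' : B, ee 0 b = Some b' & pw b' = w'.
Proof.
move=> hr hz hr' /(srel_pw hr) hb; rewrite -hb -pw_e // in hz; last lia.
rewrite -[ee 0 b]/(omap sigma (ee 1 (sigma b))); case: (ee 1 (sigma b)) hz => [c|] //= [hc].
by exists (sigma c) => //; apply: srel_pw (srel_sym hr') hc.
Qed.

Lemma pw_ee i (b : B) : 0 < i <= n -> omap (@pw s) (ee i b) = we i (pw b).
Proof. by case: i => // i hi; rewrite -pw_e. Qed.

Lemma pw_ff i (b : B) : 0 < i <= n -> omap (@pw s) (ff i b) = wf i (pw b).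
Proof. by case: i => // i hi; rewrite -pw_f. Qed.

Lemma eps0_u k (b : B) : k <= s -> pw b = blk 1 2 k -> eps 0 b = s + k.
Proof.
move=> hk hb; rewrite (eps0_srel (srel_u hk) hb) eps1_jtab //; last by case: odd.
by rewrite -{3}(subnK hk); have := odd_double_half (s - k); lia.
Qed.

Lemma phi0_u k (b : B) : k <= s -> pw b = blk 1 2 k -> phi 0 b = s - k.
Proof.
move=> hk hb; rewrite (phi0_srel (srel_u hk) hb) phi1_jtab //; last by case: odd.
by have := odd_double_half (s - k); lia.
Qed.

Lemma e0_u k (b : B) : k < s -> pw b = blk 1 2 k.+1 ->
  exists2 b' : B, ee 0 b = Some b' & pw b' = blk 1 2 k.
Proof.
move=> hk; apply: e0_srel (srel_u hk) (e1_u _ _) _.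
have -> : (s - k.+1).+1 = s - k by lia.
by apply: srel_u; lia.
Qed.

Lemma phi0_T3 j (b : B) : j + 2 <= s -> pw b = [:: bl 2, bl 1 & blk 1 2 j.+1] ->
  phi 0 b = s - (j + 2).
Proof.
move=> hj hb; have h2 : 2 <= bl 2 <= bl 2 by rewrite /bl; lia.
rewrite (phi0_srel (srel_T3 hj h2) hb) /= phi1_jtab // ?eps1_jtab //; try by case: odd.
by rewrite !sign1 //; have := odd_double_half (s - (j + 2)); lia.
Qed.

Lemma phi0_13 k (b : B) : k < s -> pw b = [:: 1, 3 & blk 1 2 k] -> phi 0 b = s - k.+1.
Proof.
move=> hk hb.
rewrite (phi0_srel (srel_13 hk) hb) /= phi1_jtab // ?eps1_jtab //; try by case: odd.
by rewrite !sign1 //; have := odd_double_half (s - k.+1); lia.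
Qed.

End Sigma.

(** * Sigma and the 0-arrows on the one-column crystal *)

Section OneColumn.
Variable sigma : B2_classical n 1 -> B2_classical n 1.
Hypothesis hsigma : is_sigma sigma.
Local Notation B := (B2 sigma).

Lemma minus_3 i : 2 < i -> minus i 3 = false.
Proof. by move=> hi; rewrite /letter_minus; lia. Qed.

Lemma minus_4 i : 2 < i -> minus i 4 = (i == 3).
Proof. by move=> hi; rewrite /letter_minus; lia. Qed.

Lemma plus_3 i : 2 < i -> plus i 3 = (i == 3) || (i == 4) && (n == 4).
Proof. by move=> hi; rewrite /letter_plus; lia. Qed.

Lemma minus_b3 i : 2 < i -> minus i (bl 3) = (i == 3) || (i == 4) && (n == 4).
Proof. by move=> hi; rewrite /letter_minus /bl; lia. Qed.

Lemma srel_1y y : 2 <= y <= bl 2 -> srel sigma [:: 1; y] [:: y; bl 1].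
Proof.
have h1 : 2 <= 2 < n by lia.
apply: (srel_chain hsigma (P := [:: 1]) (Q := [::]) (P' := [::]) (Q' := [:: bl 1]) h1).
- move=> i hi; split=> //=; have [->|hi2] := eqVneq i 2; first by rewrite sign2.
  by rewrite sign3 //; lia.
- move=> i hi; split=> //=; have [->|hi2] := eqVneq i 2; first by rewrite sign2.
  by rewrite sign3 //; lia.
exact: (srel_u hsigma (k := 1)).
Qed.

(** Here lambda_2 = 1, so the words [jtab] do not apply. For s = 1 sigma fixes the parameters (1, 1,
    1, 0), and weight delta_2 + delta_3 in one column forces [2; 3]. *)
Lemma srel_23 : srel sigma [:: 2; 3] [:: 2; 3].
Proof.
have [b hb] : exists b : B2_classical n 1, pw b = [:: 2; 3].
  by apply: pw_ex => //=; rewrite /col_ok; lia.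
have hcount (p : nat) : count_mem p (pw b) = (2 == p) + (3 == p) by rewrite hb /= addn0.
have : has_params b 1 1 1 0.
  split.
  - move=> i hi; have : we i (pw b) == None.
      rewrite we_None // hb /=; have [->|hi2] := eqVneq i 2; first by rewrite !sign2.
      by rewrite /= sign3 ?minus_3 //; lia.
    by rewrite -pw_e //; [case: (ee i b) | lia].
  - by have := size_pw b; rewrite hb => /(@double_inj 1).
  apply/rowP => j; rewrite wt_pw // !hcount !mxE mul0r add0r !natz.
  have hj := ltn_ord j.
  have -> : (2 == bl j.+1) = false by clear -hn hj; rewrite /bl; lia.
  have -> : (3 == bl j.+1) = false by clear -hn hj; rewrite /bl; lia.
  rewrite !(eq_sym _ j.+1) subr0 !mul1r -PoszD //.
have [_ _ hp] := hsigma; case/hp => _ hk hw.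
exists b => //; move: hk hw (pw_ktab (sigma b)) (size_pw (sigma b)).
rewrite addnK => -> hw; case E: (pw _) => [|x [|y []]] // kt _.
have h2 : 1 < n by lia.
have h3 : 2 < n by lia.
have := wt_pw (sigma b) (Ordinal h2); have := wt_pw (sigma b) (Ordinal h3).
rewrite hw E !mxE /= oppr0 !mul0r !add0r !natz !addn0 /= => e3 e2.
have x2 : (x == 2) || (y == 2).
  by move: e2; case: (x == 2); case: (y == 2) => //; clear; lia.
have x3 : (x == 3) || (y == 3).
  by move: e3; case: (x == 3); case: (y == 3) => //; clear; lia.
move: kt; rewrite /= andbT; case/orP: x2 => /eqP ex; case/orP: x3 => /eqP ey; subst => //.
by rewrite /col_ok; lia.
Qed.

Lemma srel_2y y : 3 <= y <= bl 3 -> srel sigma [:: 2; y] [:: 2; y].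
Proof.
have h1 : 2 <= 3 < n by lia.
apply: (srel_chain hsigma (P := [:: 2]) (Q := [::]) (P' := [:: 2]) (Q' := [::]) h1).
- by move=> i hi; split=> //=; rewrite sign3 //; lia.
- by move=> i hi; split=> //=; rewrite sign3 //; lia.
exact: srel_23.
Qed.

(** A path of f_i with i >= 2 leads here from the fixed column [2; 3]. As [3; bar 3] meets no
    1-arrow, it meets no 0-arrow either. *)
Lemma srel_33 : srel sigma [:: 3; bl 3] [:: 3; bl 3].
Proof.
have h : 3 <= bl 3 <= bl 3 by rewrite /bl; lia.
have h2 : 2 <= 2 <= n by lia.
have e : wf 2 [:: 2; bl 3] = Some [:: 3; bl 3].
  by rewrite /= !sign2 // /letter_jump (_ : (2 == n) = false) //; lia.
exact: (srel_f hsigma h2 (srel_2y h) e e).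
Qed.

Lemma srel_low : srel sigma [:: bl 2; bl 1] [:: 1; bl 2].
Proof. by apply: srel_sym => //; apply: srel_1y; rewrite /bl; lia. Qed.

(** Sigma sends the empty tableau to [2; bar 2], e_1 sends this to [1; bar 2], and sigma sends that
    to [bar 2; bar 1]. *)
Lemma e0_nil (b : B) : pw b = [::] -> exists2 b' : B, ee 0 b = Some b' & pw b' = [:: bl 2; bl 1].
Proof.
apply: (e0_srel hsigma (srel_u hsigma (leq0n 1)) _ srel_low).
by rewrite (_ : jtab _ _ _ _ = jtab 0 1 0 0) // e1_jtab1.
Qed.

Lemma eps0_low (b : B) : pw b = [:: bl 2; bl 1] -> eps 0 b = 0.
Proof. by move=> hb; rewrite (eps0_srel hsigma srel_low hb) /= !sign1. Qed.

Lemma phi0_low (b : B) : pw b = [:: bl 2; bl 1] -> phi 0 b = 2.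
Proof. by move=> hb; rewrite (phi0_srel hsigma srel_low hb) /= !sign1. Qed.

Lemma eps0_33 (b : B) : pw b = [:: 3; bl 3] -> eps 0 b = 0.
Proof. by move=> hb; rewrite (eps0_srel hsigma srel_33 hb) /= !sign1. Qed.

Lemma phi0_33 (b : B) : pw b = [:: 3; bl 3] -> phi 0 b = 0.
Proof. by move=> hb; rewrite (phi0_srel hsigma srel_33 hb) /= !sign1. Qed.

Lemma srel_31 : srel sigma [:: 1; 3] [:: 3; bl 1].
Proof. by apply: srel_1y; rewrite /bl; lia. Qed.

Lemma eps0_col13 (b : B) : pw b = [:: 1; 3] -> eps 0 b = 1.
Proof. by move=> hb; rewrite (eps0_srel hsigma srel_31 hb) /= !sign1. Qed.

Lemma phi0_col13 (b : B) : pw b = [:: 1; 3] -> phi 0 b = 0.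
Proof. by move=> hb; rewrite (phi0_srel hsigma srel_31 hb) /= !sign1. Qed.

End OneColumn.

(** * Affine operators on tensor products *)

Section Tensor.
Variables s t : nat.
Variable sigma : B2_classical n s -> B2_classical n s.
Variable tau : B2_classical n t -> B2_classical n t.
Hypotheses (hsigma : is_sigma sigma) (htau : is_sigma tau).

(* For [i = 0] the operators are those of index 1 after twisting by sigma. *)
Definition affw m (rho : B2_classical n m -> B2_classical n m) i (b : B2 rho) : seq nat :=
  if i == 0 then pw (rho b) else pw b.
Definition affi (i : nat) : nat := if i == 0 then 1 else i.

Lemma affw_e m (rho : B2_classical n m -> B2_classical n m) i (b : B2 rho) :
  is_sigma rho -> i <= n -> omap (affw i) (ee i b) = we (affi i) (affw i b).
Proof.
case=> inv _ _; case: i => [_|i hi]; last exact: pw_ee.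
rewrite -[affi 0]/1 -[affw 0 b]/(pw (rho b)) -pw_e //; last lia.
rewrite -[ee 0 b]/(omap rho (ee 1 (rho b))).
by case: (ee 1 (rho b)) => [b'|] //=; rewrite /affw /= inv.
Qed.

Lemma affw_f m (rho : B2_classical n m -> B2_classical n m) i (b : B2 rho) :
  is_sigma rho -> i <= n -> omap (affw i) (ff i b) = wf (affi i) (affw i b).
Proof.
case=> inv _ _; case: i => [_|i hi]; last exact: pw_ff.
rewrite -[affi 0]/1 -[affw 0 b]/(pw (rho b)) -pw_f //; last lia.
rewrite -[ff 0 b]/(omap rho (ff 1 (rho b))).
by case: (ff 1 (rho b)) => [b'|] //=; rewrite /affw /= inv.
Qed.

Lemma eps_aff m (rho : B2_classical n m -> B2_classical n m) i (b : B2 rho) :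
  is_sigma rho -> i <= n -> eps i b = weps (affi i) (affw i b).
Proof. by move=> hr hi; apply: (eps_model (h := affw i)) b => b; apply: affw_e. Qed.

Lemma phi_aff m (rho : B2_classical n m -> B2_classical n m) i (b : B2 rho) :
  is_sigma rho -> i <= n -> phi i b = wphi (affi i) (affw i b).
Proof. by move=> hr hi; apply: (phi_model (h := affw i)) b => b; apply: affw_f. Qed.

Definition taffw i (b : tens (B2 sigma) (B2 tau)) : seq nat := affw i b.1 ++ affw i b.2.

Lemma taffw_e i b : i <= n -> omap (taffw i) (ee i b) = we (affi i) (taffw i b).
Proof.
move=> hi; case: b => b1 b2; rewrite ee_tens -[taffw i (b1, b2)]/(affw i b1 ++ affw i b2) we_cat //.
rewrite eps_aff // phi_aff // -!affw_e //.
by case: ifP => _; [case: (ee i b1) | case: (ee i b2)].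
Qed.

Lemma taffw_f i b : i <= n -> omap (taffw i) (ff i b) = wf (affi i) (taffw i b).
Proof.
move=> hi; case: b => b1 b2; rewrite ff_tens -[taffw i (b1, b2)]/(affw i b1 ++ affw i b2) wf_cat //.
rewrite eps_aff // phi_aff // -!affw_f //.
by case: ifP => _; [case: (ff i b1) | case: (ff i b2)].
Qed.

Lemma eps_taff i b : i <= n -> eps i b = weps (affi i) (taffw i b).
Proof. by move=> hi; apply: (eps_model (h := taffw i)) b => b; apply: taffw_e. Qed.

Lemma phi_taff i b : i <= n -> phi i b = wphi (affi i) (taffw i b).
Proof. by move=> hi; apply: (phi_model (h := taffw i)) b => b; apply: taffw_f. Qed.

Lemma phi_tens i (b1 : B2 sigma) (b2 : B2 tau) : i <= n ->
  phi i ((b1, b2) : tens (B2 sigma) (B2 tau)) = phi i b2 + (phi i b1 - eps i b2).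
Proof. by move=> hi; rewrite phi_taff // /taffw wphi_cat // -!phi_aff // -eps_aff. Qed.

Definition e0_step (w1 w2 v1 v2 : seq nat) : Prop :=
  forall b : tens (B2 sigma) (B2 tau), pw b.1 = w1 -> pw b.2 = w2 ->
  exists b', [/\ ee 0 b = Some b', pw b'.1 = v1 & pw b'.2 = v2].

Lemma e0_step_l w1 w2 v1 p q : (forall b : B2 sigma, pw b = w1 -> phi 0 b = p) ->
  (forall b : B2 tau, pw b = w2 -> eps 0 b = q) -> q <= p ->
  (forall b : B2 sigma, pw b = w1 -> exists2 b', ee 0 b = Some b' & pw b' = v1) ->
  e0_step w1 w2 v1 w2.
Proof.
move=> hp hq hqp he [b1 b2] h1 h2; have [b' e hb'] := he _ h1.
by exists (b', b2); split=> //; rewrite ee_tens (hp _ h1) (hq _ h2) hqp e.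
Qed.

Lemma e0_step_r w1 w2 v2 p q : (forall b : B2 sigma, pw b = w1 -> phi 0 b = p) ->
  (forall b : B2 tau, pw b = w2 -> eps 0 b = q) -> p < q ->
  (forall b : B2 tau, pw b = w2 -> exists2 b', ee 0 b = Some b' & pw b' = v2) ->
  e0_step w1 w2 w1 v2.
Proof.
move=> hp hq hqp he [b1 b2] h1 h2; have [b' e hb'] := he _ h2.
by exists (b1, b'); split=> //; rewrite ee_tens (hp _ h1) (hq _ h2) leqNgt hqp e.
Qed.

End Tensor.

(** * The combinatorial R *)

Section CombR.
Variable s : nat.
Variable sigma : B2_classical n s -> B2_classical n s.
Variable sigma1 : B2_classical n 1 -> B2_classical n 1.
Hypotheses (hsigma : is_sigma sigma) (hsigma1 : is_sigma sigma1).
Variable R : tens (B2 sigma) (B2 sigma1) -> tens (B2 sigma1) (B2 sigma).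
Hypothesis hR : affine_crystal_iso R.

Definition maps_to (w1 w2 w1' w2' : seq nat) : Prop :=
  exists b, [/\ pw b.1 = w1, pw b.2 = w2, pw (R b).1 = w1' & pw (R b).2 = w2'].

Lemma maps_to_fun w1 w2 w1' w2' v1 v2 :
  maps_to w1 w2 w1' w2' -> maps_to w1 w2 v1 v2 -> w1' = v1 /\ w2' = v2.
Proof.
move=> [[b1 b2] [h1 h2 <- <-]] [[c1 c2] [k1 k2 <- <-]].
have -> : b1 = c1 by apply: pw_inj; exact: etrans h1 (esym k1).
by have -> : b2 = c2 by apply: pw_inj; exact: etrans h2 (esym k2).
Qed.

Lemma maps_to_e0 w1 w2 w1' w2' v1 v2 v1' v2' :
  maps_to w1 w2 w1' w2' -> e0_step sigma sigma1 w1 w2 v1 v2 ->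
  e0_step sigma1 sigma w1' w2' v1' v2' -> maps_to v1 v2 v1' v2'.
Proof.
move=> [b [h1 h2 h3 h4]] hX hY.
have [c [ec c1 c2]] := hX _ h1 h2; have [d [ed d1 d2]] := hY _ h3 h4.
have [_ /(_ 0 isT b) [eR _]] := hR.
exists c; rewrite ec ed in eR; case: eR => <-; by split.
Qed.

Lemma eps_R i b : i <= n -> eps i (R b) = eps i b.
Proof.
move=> hi; rewrite eps_taff //; apply/esym.
apply: (eps_model (h := fun b => taffw i (R b))) b => b.
have [_ /(_ i hi b) [eR _]] := hR.
by rewrite -taffw_e // eR; case: (ee i b).
Qed.

Lemma phi_R i b : i <= n -> phi i (R b) = phi i b.
Proof.
move=> hi; rewrite phi_taff //; apply/esym.
apply: (phi_model (h := fun b => taffw i (R b))) b => b.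
have [_ /(_ i hi b) [_ eR]] := hR.
by rewrite -taffw_f // eR; case: (ff i b).
Qed.

Lemma maps_to_eps w1 w2 w1' w2' i : maps_to w1 w2 w1' w2' -> 0 < i <= n ->
  weps i (w1 ++ w2) = weps i (w1' ++ w2').
Proof.
move=> [b [<- <- <- <-]] hi; have hi' : i <= n by lia.
by have := eps_R b hi'; rewrite !eps_taff //; case: i hi {hi'}.
Qed.

Lemma maps_to_phi w1 w2 w1' w2' i : maps_to w1 w2 w1' w2' -> 0 < i <= n ->
  wphi i (w1 ++ w2) = wphi i (w1' ++ w2').
Proof.
move=> [b [<- <- <- <-]] hi; have hi' : i <= n by lia.
by have := phi_R b hi'; rewrite !phi_taff //; case: i hi {hi'}.
Qed.

(** The left factor of the image will be u_1, with phi_0 = 0, so phi_0 of the image is that of its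
    right factor. *)
Lemma maps_to_phi0 w1 w2 w1' w2' p1 p2 q2 p2' : maps_to w1 w2 w1' w2' ->
  (forall b : B2 sigma, pw b = w1 -> phi 0 b = p1) ->
  (forall b : B2 sigma1, pw b = w2 -> phi 0 b = p2) ->
  (forall b : B2 sigma1, pw b = w2 -> eps 0 b = q2) ->
  (forall b : B2 sigma1, pw b = w1' -> phi 0 b = 0) ->
  (forall b : B2 sigma, pw b = w2' -> phi 0 b = p2') ->
  p2 + (p1 - q2) = p2'.
Proof.
move=> [b [h1 h2 h3 h4]] a1 a2 a3 a4 a5.
have := phi_R b (leq0n n); case: (R b) h3 h4 => c1 c2 h3 h4; case: b h1 h2 => b1 b2 h1 h2.
by rewrite !phi_tens // (a1 _ h1) (a2 _ h2) (a3 _ h2) (a4 _ h3) (a5 _ h4) sub0n addn0.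
Qed.

End CombR.

(** * Candidates for highest weight vectors *)

Lemma sign_3 :
  (((plus 3 1 = false) * (plus 3 2 = false) * (plus 3 3 = true) * (plus 3 4 = false)) *
  ((plus 3 (bl 1) = false) * (plus 3 (bl 2) = false) * (plus 3 (bl 3) = false)) *
  ((minus 3 1 = false) * (minus 3 2 = false) * (minus 3 3 = false) * (minus 3 4 = true)) *
  ((minus 3 (bl 1) = false) * (minus 3 (bl 2) = false) * (minus 3 (bl 3) = true)))%type.
Proof. by rewrite /letter_plus /letter_minus /bl; do !split; lia. Qed.

Lemma sign_4 :
  (((plus 4 1 = false) * (plus 4 2 = false) * (plus 4 3 = (n == 4)) * (plus 4 4 = true)) *
  ((plus 4 (bl 1) = false) * (plus 4 (bl 2) = false) * (plus 4 (bl 3) = false)) *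
  ((minus 4 1 = false) * (minus 4 2 = false) * (minus 4 3 = false) * (minus 4 4 = false)) *
  ((minus 4 (bl 1) = false) * (minus 4 (bl 2) = false) * (minus 4 (bl 3) = (n == 4))))%type.
Proof. by rewrite /letter_plus /letter_minus /bl; do !split; lia. Qed.

Lemma sign_b4 : n = 4 -> ((plus 1 5 = false) * (minus 1 5 = false) *
  (plus 2 5 = false) * (minus 2 5 = false) * (plus 3 5 = true) * (minus 3 5 = false) *
  (plus 4 5 = false) * (minus 4 5 = true))%type.
Proof. by move=> ->. Qed.

(* The pairing of the weight of the word [w] with the [i]-th coroot. *)
Fixpoint net (i : nat) (w : seq nat) : int :=
  if w is p :: w' then ((plus i p)%:Z - (minus i p)%:Z + net i w')%R else 0%R.

Lemma netE i w : ((wphi i w)%:Z - (weps i w)%:Z = net i w)%R.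
Proof. by elim: w => //= p w <-; lia. Qed.

Lemma net_cat i u v : net i (u ++ v) = (net i u + net i v)%R.
Proof. by elim: u => [|p u IH] /=; rewrite ?add0r // IH addrA. Qed.

Lemma net_blk i a b k : net i (blk a b k) = (net i [:: a; b] *+ k)%R.
Proof.
elim: k => // k IH.
by rewrite -[blk a b k.+1]/([:: a; b] ++ blk a b k) net_cat IH mulrS.
Qed.

Lemma net_u k : ((net 1 (blk 1 2 k) = 0) * (net 2 (blk 1 2 k) = k%:Z) *
  (net 3 (blk 1 2 k) = 0) * (net 4 (blk 1 2 k) = 0))%type%R.
Proof.
rewrite !net_blk /= !sign1 // !sign2 // !sign_3 !sign_4 /=.
by do !split; rewrite ?mul0rn //; lia.
Qed.

Variant hw_col (k : nat) : seq nat -> Prop :=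
| HwNil : hw_col k [::]
| Hw12 : hw_col k [:: 1; 2]
| Hw13 of 0 < k : hw_col k [:: 1; 3]
| Hw12b of 0 < k : hw_col k [:: 1; bl 2]
| Hw34 of 0 < k : hw_col k [:: 3; 4]
| Hw33b of 0 < k : hw_col k [:: 3; bl 3]
| Hw32b of 1 < k : hw_col k [:: 3; bl 2]
| Hw2b1b of 0 < k : hw_col k [:: bl 2; bl 1]
| Hw34b of n = 4 & 0 < k : hw_col k [:: 3; 5].

(** The hypothesis says eps_i(w) <= phi_i(u_k), that is, u_k (x) w is a highest weight vector. The
    bounds on k in [hw_col] are the values of eps_2(w). *)
Lemma hw_colP k w : ktab w -> size w <= 2 ->
  (forall i, 0 < i <= n -> weps i w <= (i == 2) * k) -> hw_col k w.
Proof.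
case: w => [|x [|y [|? ?]]] //; first by move=> *; constructor.
move=> kt _ he; have hxy : col_ok x y by move: kt; rewrite /= andbT.
have mx i : 0 < i <= n -> i != 2 -> ~~ minus i x.
  by move=> hi h2; have := he i hi; rewrite /= (negPf h2); case: minus.
have my i : 0 < i <= n -> i != 2 -> minus i y -> plus i x.
  move=> hi h2 hm; have := he i hi; rewrite /= (negPf h2) hm; case: plus => //; lia.
have h2n : 0 < 2 <= n by lia.
have he2 (_ : unit) : minus 2 x + (minus 2 y + (0 - plus 2 y) - plus 2 x) <= k.
  by have := he 2 h2n; rewrite /= mulnC muln1 !sub0n.
have h1n : 0 < 1 <= n by lia.
have mx1 := mx 1 h1n isT.
have hx0 : 0 < x <= n + n by case/and4P: hxy.
have hy0 : 0 < y <= n + n by case/and4P: hxy.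
have mx3 i : 2 < i <= n -> ~~ minus i x by move=> hi; apply: mx; lia.
(* Of the letters killed by e_3, ..., e_n, the letters 2 and bar 1 are not killed by e_1. *)
have hx : [\/ x = 1, x = 3 | x = bl 2].
  case: (letter_hw3 hx0 mx3) => [hx3|->|ex]; last 1 first.
  - by move: mx1; rewrite ex sign1.
  - case: x hx3 hx0 {hxy mx my he he2 mx3 kt} mx1 => [|[|[|[|x]]]] // _ _ m1; [|exfalso|].
    + by constructor 1.
    + by move: m1; rewrite sign1.
    + by constructor 2.
  by constructor 3.
case: hx => ex; subst x.
- have my3 i : 2 < i <= n -> ~~ minus i y.
    by move=> hi; apply/negP => /my; rewrite sign3 //; lia.
  case: (letter_hw3 hy0 my3) => [hy3|ey|ey].
  + have [ey|ey] : y = 2 \/ y = 3 by move: hxy; rewrite /col_ok; lia.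
      by rewrite ey; exact: Hw12.
    by rewrite ey; apply: Hw13; move: (he2 tt); rewrite ey !sign2.
  + by subst y; apply: Hw12b; move: (he2 tt); rewrite !sign2.
  + by subst y; move: hxy; rewrite /col_ok /bl; lia.
(* Below a 3, an i-arrow into y with i != 2 must be matched by an i-arrow out of 3: i = 3, or i = 4
   when n = 4. The latter admits the column [3; bar 4] of case (14). *)
- have hy3 : 3 < y by move: hxy; rewrite /col_ok; lia.
  have [hyn|hyn] := leqP y n.
    have [ey|hy4] := eqVneq y 4; first by subst y; apply: Hw34; move: (he2 tt); rewrite !sign2.
    have h5 : 0 < y.-1 <= n by lia.
    have h6 : y.-1 != 2 by lia.
    have h7 : minus y.-1 y by rewrite /letter_minus; lia.
    by have := my _ h5 h6 h7; rewrite plus_3 //; lia.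
  have [ey|hyn1] := eqVneq y n.+1.
    have h5 : 0 < n <= n by lia.
    have h6 : n != 2 by lia.
    have h7 : minus n y by rewrite /letter_minus ey; lia.
    have n4 : n = 4 by have := my _ h5 h6 h7; rewrite plus_3 //; lia.
    have -> : y = 5 by rewrite ey n4.
    apply: Hw34b => //; move: (he2 tt); rewrite !sign2 //; lia.
  have [j hj ey] : exists2 j, 0 < j < n & y = bl j.
    by exists ((n + n).+1 - y); rewrite /bl; lia.
  have hm : minus j y by rewrite /letter_minus ey /bl; lia.
  have [j2|j2] := eqVneq j 2.
    by rewrite ey j2; apply: Hw32b; move: (he2 tt); rewrite ey j2 !sign2.
  have h5 : 0 < j <= n by lia.
  have := my _ h5 j2 hm; have [j1|j1] := eqVneq j 1.
    by rewrite j1 sign1.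
  rewrite plus_3 //; last lia.
  move=> h; have j3 : j = 3 by lia.
  by rewrite ey j3; apply: Hw33b; move: (he2 tt); rewrite ey j3 !sign2.
have ey : y = bl 1 by move: hxy; rewrite /col_ok /bl; lia.
by rewrite ey; apply: Hw2b1b; move: (he2 tt); rewrite ey !sign2.
Qed.

(** * The fourteen cases *)

Section Main.
Variable s : nat.
Hypothesis hs : 1 <= s.
Variable sigma : B2_classical n s -> B2_classical n s.
Variable sigma1 : B2_classical n 1 -> B2_classical n 1.
Hypotheses (hsigma : is_sigma sigma) (hsigma1 : is_sigma sigma1).
Variable R : tens (B2 sigma) (B2 sigma1) -> tens (B2 sigma1) (B2 sigma).
Hypothesis hR : affine_crystal_iso R.
Local Notation u := (blk 1 2).
Local Notation maps := (maps_to R).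

Lemma maps_target w1' w2' : ktab w1' -> size w1' <= 2 ->
  ktab w2' -> size w2' <= s.*2 ->
  (forall i, 0 < i <= n -> weps i (w1' ++ w2') = 0) ->
  exists k w2, [/\ k <= s, hw_col k w2 & maps (u k) w2 w1' w2'].
Proof.
move=> k1 z1 k2 z2 hw.
have [c1 hc1] : exists c : B2 sigma1, pw c = w1' by apply: pw_ex.
have [c2 hc2] : exists c : B2 sigma, pw c = w2' by apply: pw_ex.
have [[R' RK KR] _] := hR.
case E : (R' (c1, c2)) => [b1 b2].
have eR : R (b1, b2) = (c1, c2) by rewrite -E KR.
have hm : maps (pw b1) (pw b2) w1' w2' by exists (b1, b2); rewrite eR; split.
have he i : 0 < i <= n -> weps i (pw b1 ++ pw b2) = 0.
  by move=> hi; rewrite (maps_to_eps hsigma hsigma1 hR hm hi); apply: hw.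
have hk : (tag b1 : nat) <= s by have := ltn_ord (tag b1).
have hb1 : pw b1 = u (tag b1).
  rewrite (ktab_hw (pw_ktab b1)) ?size_pw ?doubleK // => i hi.
  by have := he i hi; rewrite weps_cat //; clear; lia.
exists (tag b1), (pw b2); rewrite -hb1; split=> //.
apply: (hw_colP (pw_ktab b2)).
  by rewrite size_pw; have := ltn_ord (tag b2); clear; lia.
move=> i hi; have := he i hi; rewrite weps_cat // hb1.
suff -> : wphi i (u (tag b1)) = (i == 2) * tag b1 by clear; lia.
case: i hi => [|[|[|i]]] // _; first by rewrite blk_one1.
  by rewrite blk_two // mul1n.
by rewrite blk_three.
Qed.

Lemma maps_net w1 w2 w1' w2' i : maps w1 w2 w1' w2' -> 0 < i <= n ->
  (net i w1 + net i w2 = net i w1' + net i w2')%R.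
Proof.
move=> hm hi; rewrite -!net_cat -!netE.
by rewrite (maps_to_eps hsigma hsigma1 hR hm hi) (maps_to_phi hsigma hsigma1 hR hm hi).
Qed.

Variant target_spec w1' w2' : Prop :=
  TargetSpec k w2 of k <= s & hw_col k w2 & maps (u k) w2 w1' w2'
  & (net 1 w2 = net 1 w1' + net 1 w2')%R
  & (k%:Z + net 2 w2 = net 2 w1' + net 2 w2')%R
  & (net 3 w2 = net 3 w1' + net 3 w2')%R
  & (net 4 w2 = net 4 w1' + net 4 w2')%R.

Lemma targetP w1' w2' : ktab w1' -> size w1' <= 2 -> ktab w2' -> size w2' <= s.*2 ->
  (forall i, 0 < i <= n -> weps i (w1' ++ w2') = 0) -> target_spec w1' w2'.
Proof.
move=> k1 z1 k2 z2 hw; have [k [w2 [hk hc hm]]] := maps_target k1 z1 k2 z2 hw.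
have h i : 0 < i <= 4 -> (net i (u k) + net i w2 = net i w1' + net i w2')%R.
  by move=> hi; apply: (maps_net hm); clear -hn hi; lia.
by apply: (TargetSpec hk hc hm);
  [have := h 1 isT | have := h 2 isT | have := h 3 isT | have := h 4 isT]; rewrite net_u ?add0r.
Qed.

Lemma target1P w2' : ktab w2' -> size w2' <= s.*2 ->
  (forall i, 0 < i <= n -> weps i w2' <= (i == 2)) -> target_spec [:: 1; 2] w2'.
Proof.
move=> k2 z2 hw; apply: targetP => //; first exact: (ktab_blk12 1).
move=> i hi; rewrite weps_cat //; have := hw i hi.
case: i hi {hw} => [|[|[|i]]] // _; rewrite /= ?sign1 ?sign2 ?sign3 //; clear; lia.
Qed.

Ltac nets := rewrite /= ?net_u /= ?sign1 ?sign2 ?sign_3 ?sign_4 /=.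
(** Runs through the possible preimages and discards those whose weight, or whose bounds on k,
    contradict the target. *)
Ltac target H :=
  case: H => k w2 hk [||h|h|h|h|h|h|n4 h] hm; rewrite ?(net_cat, net_u); nets;
  try match goal with e : n = 4 |- _ => rewrite ?(sign_b4 e) /= end;
  try match goal with a : is_true (_ <= s), e : is_true (_ < _) |- _ => by move: a e; clear; lia end;
  try match goal with a : is_true (_ <= s) |- _ => by move: a; clear; lia end.

Lemma hw_u1 k i : 0 < i <= n -> weps i (u k) <= (i == 2).
Proof. by case: i => [|[|[|i]]] // _; rewrite ?blk_one1 ?blk_two ?blk_three. Qed.

Lemma hw_cons x y k i : weps i [:: x; y] <= (i == 2) -> 0 < i <= n ->
  weps i [:: x, y & u k] <= (i == 2).
Proof.
move=> h hi; rewrite -[[:: x, y & u k]]/([:: x; y] ++ u k) weps_cat //.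
suff -> : weps i (u k) = 0 by rewrite sub0n addn0.
by case: i hi {h} => [|[|[|i]]] // _; rewrite ?blk_one1 ?blk_two ?blk_three.
Qed.

Lemma ktab_cons x y k : col_ok x y -> cols_ok x y 1 2 -> ktab [:: x, y & u k].
Proof. by case: k => [|k] h1 h2; rewrite /= ?h1 // h2; apply: (ktab_blk12 k.+1). Qed.

Lemma size_cons2 x y k : k < s -> size [:: x, y & u k] <= s.*2.
Proof. by rewrite /= size_blk -doubleS leq_double. Qed.

Lemma down (P : nat -> Prop) m N : P N -> (forall k, m <= k < N -> P k.+1 -> P k) ->
  forall k, m <= k <= N -> P k.
Proof.
move=> PN step k hk; rewrite -(subKn (proj2 (andP hk))).
have : N - k <= N - m by clear -hk; lia.
elim: (N - k) => [|j IH] hj; first by rewrite subn0.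
by apply: step; [clear -hj hk; lia|rewrite subnSK; [apply: IH|]; clear -hj hk; lia].
Qed.

Lemma stepX_l k w2 q : k < s -> (forall b : B2 sigma1, pw b = w2 -> eps 0 b = q) ->
  q <= s - k.+1 -> e0_step sigma sigma1 (u k.+1) w2 (u k) w2.
Proof.
move=> hk hq hqk; apply: e0_step_l hq hqk _ => b; last exact: e0_u.
exact: phi0_u.
Qed.

Lemma stepX_r k w2 v2 q : k <= s -> (forall b : B2 sigma1, pw b = w2 -> eps 0 b = q) ->
  s - k < q ->
  (forall b : B2 sigma1, pw b = w2 -> exists2 b', ee 0 b = Some b' & pw b' = v2) ->
  e0_step sigma sigma1 (u k) w2 (u k) v2.
Proof. by move=> hk hq hqk; apply: e0_step_r hq hqk => b; apply: phi0_u. Qed.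

(** On the target side e_0 always acts on the right factor: phi_0(u_l) = 1 - l is less than
    eps_0(u_{k+1}) = s + k + 1. *)
Lemma stepY k l : k < s -> l <= 1 -> e0_step sigma1 sigma (u l) (u k.+1) (u l) (u k).
Proof.
move=> hk hl; apply: (@e0_step_r _ _ _ _ _ _ _ (1 - l) (s + k.+1)) => [b|b||b].
- exact: phi0_u.
- exact: eps0_u.
- by clear -hs hl; lia.
exact: e0_u.
Qed.

Lemma eps0_12 (b : B2 sigma1) : pw b = u 1 -> eps 0 b = 2.
Proof. exact: eps0_u. Qed.

Lemma eps0_nil (b : B2 sigma1) : pw b = u 0 -> eps 0 b = 1.
Proof. exact: eps0_u. Qed.

Lemma phi0_nil (b : B2 sigma1) : pw b = u 0 -> phi 0 b = 1.
Proof. exact: phi0_u. Qed.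

Lemma phi0_12 (b : B2 sigma1) : pw b = u 1 -> phi 0 b = 0.
Proof. exact: phi0_u. Qed.

(** The three other candidates of weight (s + 1) Lambda_2 would need k > s. *)
Lemma R_us_u1 : maps (u s) (u 1) (u 1) (u s).
Proof.
have H : target_spec [:: 1; 2] (u s).
  by apply: target1P; [exact: ktab_blk12 | rewrite size_blk | exact: hw_u1].
target H => _ e _ _; have ek : k = s by clear -e; lia.
by rewrite ek in hm.
Qed.

Lemma R_us_nil : maps (u s) (u 0) (u 1) (u (s - 1)).
Proof.
have es : u s = u (s - 1).+1 by rewrite subn1 prednK.
apply: (maps_to_e0 hR R_us_u1).
  by apply: (stepX_r (leqnn s) eps0_12); [rewrite subnn | move=> b; apply: e0_u].
by rewrite es; apply: stepY => //; clear -hs; lia.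
Qed.

(** For k = s, apply e_0 to case (10): since phi_0(u_s) = 0, it acts on the empty factor. From then
    on it acts on u_k, because eps_0([bar 2; bar 1]) = 0. *)
Lemma R_u_low k : 2 <= k <= s -> maps (u k) [:: bl 2; bl 1] (u 1) (u (k - 2)).
Proof.
move=> hk; have h2 : 1 < s by clear -hk; lia.
apply: (@down (fun k => maps (u k) [:: bl 2; bl 1] (u 1) (u (k - 2))) 2 s) hk.
  have es : u (s - 1) = u (s - 2).+1 by congr blk; clear -h2; lia.
  apply: (maps_to_e0 hR R_us_nil).
    by apply: (stepX_r (leqnn s) eps0_nil); [rewrite subnn | move=> b; apply: e0_nil].
  by rewrite es; apply: stepY => //; clear -h2; lia.
move=> j hj hm; apply: (maps_to_e0 hR hm).
  by apply: (@stepX_l j _ 0) => [|b|]; [clear -hj; lia | apply: eps0_low | ].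
have -> : j.+1 - 2 = (j - 2).+1 by clear -hj; lia.
by apply: stepY => //; clear -hj; lia.
Qed.

(* If R sent u_s (x) [3; bar 3] to empty (x) u_s, then by e_0^s it would send
   empty (x) [3; bar 3], which is not killed by e_2, to empty (x) empty. *)
Lemma R_pred_u1 : maps (u (s - 1)) (u 1) (u 0) (u s).
Proof.
have H : target_spec [::] (u s).
  apply: targetP; rewrite ?ktab_blk12 ?size_blk // => i hi.
  by case: i hi => [|[|[|i]]] // _; rewrite ?blk_one1 ?blk_two ?blk_three.
target H => _ e _ _.
- have ek : k = s by clear -e; lia.
  by rewrite ek in hm; case: (maps_to_fun hm R_us_nil).
- have ek : k = s - 1 by clear -e; lia.
  by rewrite ek in hm.
have ek : k = s by clear -e; lia.
rewrite ek in hm.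
have : maps (u 0) [:: 3; bl 3] (u 0) (u 0).
  apply: (@down (fun k => maps (u k) [:: 3; bl 3] [::] (u k)) 0 s) => // j hj hj'.
  apply: (maps_to_e0 hR hj').
    by apply: (@stepX_l j _ 0) => // b; apply: eps0_33.
  by apply: (@stepY j 0).
have h2 : 0 < 2 <= n by clear -hn; lia.
by move/(maps_to_eps hsigma hsigma1 hR)/(_ h2); rewrite /= !sign2.
Qed.

(** On u_{s-1} (x) u_1 one has phi_0 = 1 < 2 = eps_0, so e_0 empties the right factor. Afterwards
    phi_0(u_k) >= 1 = eps_0(empty) for the k that occur, and e_0 lowers k. *)
Lemma R_u_nil k : k < s -> maps (u k) (u 0) (u 0) (u k).
Proof.
move=> hk; have hk' : 0 <= k <= s - 1 by clear -hk; lia.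
apply: (@down (fun k => maps (u k) [::] [::] (u k)) 0 (s - 1)) hk'.
  have es : u s = u (s - 1).+1 by rewrite subn1 prednK.
  apply: (maps_to_e0 hR R_pred_u1).
    apply: (stepX_r (leq_subr 1 s) eps0_12); first by rewrite subKn.
    by move=> b; apply: e0_u.
  by rewrite es; apply: (@stepY _ 0) => //; clear -hs; lia.
move=> j hj hj'; apply: (maps_to_e0 hR hj').
  by apply: (stepX_l _ eps0_nil); clear -hj; lia.
by apply: (@stepY _ 0) => //; clear -hj; lia.
Qed.

Lemma ktab_low : ktab [:: bl 2; bl 1].
Proof. by rewrite /= andbT /col_ok /bl; clear -hn; lia. Qed.

Lemma R_u1_low : maps (u 1) [:: bl 2; bl 1] (u 1) [:: bl 2; bl 1].
Proof.
have H : target_spec [:: 1; 2] [:: bl 2; bl 1].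
  apply: target1P; [exact: ktab_low | by rewrite /= -[2]/(1.*2) leq_double |].
  by move=> i hi; apply: (@hw_cons _ _ 0) => //;
     case: i hi => [|[|[|i]]] // _; rewrite /= ?sign1 ?sign2 ?sign3.
target H => _ e _ _.
- have ek : k = 0 by clear -e; lia.
  by rewrite ek in hm; case: (maps_to_fun hm (R_u_nil hs)).
have ek : k = 1 by clear -e; lia.
by rewrite ek in hm.
Qed.

(** The candidates with right factor empty, u_1, [3; bar 3], [bar 2; bar 1] have phi_0 equal to
    s-j-1, s-j-2, s-j-1, s-j respectively; the target has s-j-2. *)
Lemma R_u_u1 j : j + 2 <= s -> maps (u j) (u 1) (u 1) [:: bl 2, bl 1 & u j.+1].
Proof.
move=> hj.
have H : target_spec [:: 1; 2] [:: bl 2, bl 1 & u j.+1].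
  apply: target1P.
  - apply: ktab_cons; first by have := ktab_low; rewrite /= andbT.
    by rewrite /cols_ok /col_ok /row_le /bl; clear -hn; lia.
  - by apply: size_cons2; clear -hj; lia.
  by move=> i hi; apply: hw_cons => //;
     case: i hi => [|[|[|i]]] // _; rewrite /= ?sign1 ?sign2 ?sign3.
have p3 := phi0_T3 hsigma hj.
target H => _ e _ _.
- have ek : k = j.+1 by clear -e; lia.
  have := maps_to_phi0 hsigma hsigma1 hR hm (fun b => phi0_u hsigma hk) phi0_nil eps0_nil phi0_12 p3.
  by rewrite ek; clear -hj; lia.
- have ek : k = j by clear -e; lia.
  by rewrite ek in hm.
- have ek : k = j.+1 by clear -e; lia.
  have := maps_to_phi0 hsigma hsigma1 hR hm (fun b => phi0_u hsigma hk)
    (phi0_33 hsigma1) (eps0_33 hsigma1) phi0_12 p3.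
  by rewrite ek; clear -hj; lia.
have ek : k = j.+2 by clear -e; lia.
have := maps_to_phi0 hsigma hsigma1 hR hm (fun b => phi0_u hsigma hk)
    (phi0_low hsigma1) (eps0_low hsigma1) phi0_12 p3.
by rewrite ek; clear -hj; lia.
Qed.

Lemma hw_33 i : 0 < i <= n -> weps i [:: 3; bl 3] <= (i == 2).
Proof.
move=> hi; have [->|h1] := eqVneq i 1; first by rewrite /= !sign1.
have [->|h2] := eqVneq i 2; first by rewrite /= !sign2.
have h3 : 2 < i by clear -hi h1 h2; lia.
by rewrite /= minus_3 // minus_b3 // sub0n addn0 plus_3 // subnn.
Qed.

Lemma hw_13 i : 0 < i <= n -> weps i [:: 1; 3] <= (i == 2).
Proof.
move=> hi; have [->|h1] := eqVneq i 1; first by rewrite /= !sign1.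
have [->|h2] := eqVneq i 2; first by rewrite /= !sign2.
have h3 : 2 < i by clear -hi h1 h2; lia.
by rewrite /= minus_3 // sign3.
Qed.

Lemma hw_34 i : 0 < i <= n -> weps i [:: 3; 4] <= (i == 2).
Proof.
move=> hi; have [->|h1] := eqVneq i 1; first by rewrite /= !sign1.
have [->|h2] := eqVneq i 2; first by rewrite /= !sign2.
have h3 : 2 < i by clear -hi h1 h2; lia.
by rewrite /= minus_3 // minus_4 // plus_3 //; case: eqP => //; rewrite sub0n.
Qed.

Lemma ktab_33 k : ktab [:: 3, bl 3 & u k].
Proof.
by apply: ktab_cons; rewrite /cols_ok /col_ok /row_le /bl; clear -hn; lia.
Qed.

Lemma ktab_13 k : ktab [:: 1, 3 & u k].
Proof.
by apply: ktab_cons; rewrite /cols_ok /col_ok /row_le /bl; clear -hn; lia.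
Qed.

(** The three other vectors of this weight have images already known from cases (10) or (11), (2) or
    (3), and (13). *)
Lemma R_u_33bar k0 : k0 < s -> maps (u k0.+1) [:: 3; bl 3] (u 1) [:: 3, bl 3 & u k0].
Proof.
move=> hk0.
have H : target_spec [:: 1; 2] [:: 3, bl 3 & u k0].
  apply: target1P; [exact: ktab_33 | exact: size_cons2 |].
  by move=> i hi; apply: hw_cons => //; apply: hw_33.
target H => _ e _ _.
- have ek : k = k0.+1 by clear -e; lia.
  have [es|ns] := eqVneq k s.
    rewrite es in hm; case: (maps_to_fun hm R_us_nil) => _.
    by case: (s - 1).
  have hks : k < s by clear -hk ns; lia.
  by case: (maps_to_fun hm (R_u_nil hks)).
- have ek : k = k0 by clear -e; lia.
  have [es|ns] := eqVneq k (s - 1).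
    by rewrite es in hm; case: (maps_to_fun hm R_pred_u1).
  have hks : k + 2 <= s by clear -hk0 ek ns; lia.
  case: (maps_to_fun hm (R_u_u1 hks)) => _ [].
  by rewrite /bl; clear -hn; lia.
- have ek : k = k0.+1 by clear -e; lia.
  by rewrite ek in hm.
have hk2 : 2 <= k <= s by clear -hk e; lia.
by case: (maps_to_fun hm (R_u_low hk2)) => _; case: (k - 2).
Qed.

(** The rival u_{k0+1} (x) [1; 3] has phi_0 = s - k0 - 2, one less than the target. *)
Lemma R_u_32bar k0 : k0.+1 < s -> maps (u k0.+2) [:: 3; bl 2] (u 1) [:: 1, 3 & u k0].
Proof.
move=> hk0; have hk0' : k0 < s by clear -hk0; lia.
have H : target_spec [:: 1; 2] [:: 1, 3 & u k0].
  apply: target1P; [exact: ktab_13 | exact: size_cons2 |].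
  by move=> i hi; apply: hw_cons => //; apply: hw_13.
have p13 := phi0_13 hsigma hk0'.
target H => _ e _ _.
- have ek : k = k0.+1 by clear -e; lia.
  have := maps_to_phi0 hsigma hsigma1 hR hm (fun b => phi0_u hsigma hk)
    (phi0_col13 hsigma1) (eps0_col13 hsigma1) phi0_12 p13.
  by rewrite ek; clear -hk0; lia.
have ek : k = k0.+2 by clear -e; lia.
by rewrite ek in hm.
Qed.

(** The rival with right factor [3; bar 2] would need k = s + 1. *)
Lemma R_us_13 : maps (u s) [:: 1; 3] (u 1) [:: 1, 3 & u (s - 1)].
Proof.
have H : target_spec [:: 1; 2] [:: 1, 3 & u (s - 1)].
  apply: target1P; [exact: ktab_13 | apply: size_cons2; clear -hs; lia |].
  by move=> i hi; apply: hw_cons => //; apply: hw_13.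
target H => _ e _ _.
have ek : k = s by move: e hs; clear; lia.
by rewrite ek in hm.
Qed.

Lemma R_u_13 k0 : k0.+1 < s -> maps (u k0.+1) [:: 1; 3] (u 1) [:: 3, bl 3, 1, 3 & u k0].
Proof.
move=> hk0; have hk0' : k0 < s by clear -hk0; lia.
have H : target_spec [:: 1; 2] [:: 3, bl 3, 1, 3 & u k0].
  apply: target1P.
  - rewrite -[ktab _]/(cols_ok 3 (bl 3) 1 3 && ktab [:: 1, 3 & u k0]) ktab_13 andbT.
    by rewrite /cols_ok /col_ok /row_le /bl; clear -hn; lia.
  - by rewrite /= size_blk -!doubleS leq_double.
  move=> i hi; rewrite -[[:: 3, _, 1, 3 & _]]/([:: 3; bl 3] ++ [:: 1, 3 & u k0]) weps_cat //.
  have := hw_33 hi; have := hw_cons k0 (hw_13 hi) hi.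
  have [->|h2] := eqVneq i 2; first by rewrite /= !sign2 // blk_two.
  by rewrite !leqn0 => /eqP -> /eqP ->.
target H => _ e _ _.
  have ek : k = k0.+1 by clear -e; lia.
  by rewrite ek in hm.
have ek : k = k0.+2 by clear -e; lia.
by rewrite ek in hm; case: (maps_to_fun hm (R_u_32bar hk0)).
Qed.

(** No other column in [hw_col] has the weight of [3; 4] up to multiples of Lambda_2; the same
    reason settles [1; bar 2] and [3; bar 4] below. *)
Lemma R_u_34 k0 : k0 < s -> maps (u k0.+1) [:: 3; 4] (u 1) [:: 3, 4 & u k0].
Proof.
move=> hk0.
have H : target_spec [:: 1; 2] [:: 3, 4 & u k0].
  apply: target1P; [|exact: size_cons2 |].
    by apply: ktab_cons; rewrite /cols_ok /col_ok /row_le /bl; clear -hn; lia.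
  by move=> i hi; apply: hw_cons => //; apply: hw_34.
target H => _ e _ _.
have ek : k = k0.+1 by clear -e; lia.
by rewrite ek in hm.
Qed.

Lemma R_u_12bar k0 : k0 < s -> maps (u k0.+1) [:: 1; bl 2] (u 1) [:: 1, bl 2 & u k0].
Proof.
move=> hk0.
have H : target_spec [:: 1; 2] [:: 1, bl 2 & u k0].
  apply: target1P; [|exact: size_cons2 |].
    by apply: ktab_cons; rewrite /cols_ok /col_ok /row_le /bl; clear -hn; lia.
  by move=> i hi; apply: hw_cons => //;
     case: i hi => [|[|[|i]]] // _; rewrite /= ?sign1 ?sign2 ?sign3.
target H => _ e _ _.
have ek : k = k0.+1 by clear -e; lia.
by rewrite ek in hm.
Qed.

Lemma R_u_34bar k0 : n = 4 -> k0 < s -> maps (u k0.+1) [:: 3; 5] (u 1) [:: 3, 5 & u k0].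
Proof.
move=> hn4 hk0.
have H : target_spec [:: 1; 2] [:: 3, 5 & u k0].
  apply: target1P; [|exact: size_cons2 |].
    by apply: ktab_cons; rewrite /cols_ok /col_ok /row_le; clear -hn4; lia.
  move=> i hi; apply: hw_cons => //; have hi5 : i < 5 by clear -hi hn4; lia.
  have e4 : n == 4 by apply/eqP.
  case: i hi hi5 => [|[|[|[|[|i]]]]] // _ _;
    by rewrite /= ?(sign_b4 hn4) ?sign1 ?sign2 ?sign_3 ?sign_4 ?e4.
target H => _ e _ _.
have ek : k = k0.+1 by clear -e; lia.
by rewrite ek in hm.
Qed.

Lemma sends_maps w1 w2 w1' w2' t1 t2 t1' t2' : maps w1 w2 w1' w2' ->
  tabp w1 = t1 -> tabp w2 = t2 -> tabp w1' = t1' -> tabp w2' = t2' ->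
  sends R t1 t2 t1' t2'.
Proof.
by move=> [[b1 b2] [h1 h2 h3 h4]] <- <- <- <-; exists b1, b2; rewrite !pw_tab // -h1 -h2 -h3 -h4.
Qed.

Lemma lblp_pos p : p <= n -> lblp p = pos p.
Proof. by move=> h; rewrite /lblp h. Qed.

Lemma lblp_bl j : 0 < j <= n -> lblp (bl j) = bar j.
Proof.
move=> h; rewrite /lblp (_ : (bl j <= n) = false); last by rewrite /bl; clear -h; lia.
by congr bar; rewrite /bl; clear -h; lia.
Qed.

Lemma tabp_cons x y w : tabp [:: x, y & w] = rcons (tabp w) (lblp x, lblp y).
Proof. by []. Qed.

Lemma lblps : (lblp 1 = pos 1) * (lblp 2 = pos 2) * (lblp 3 = pos 3) *
  (lblp 4 = pos 4) * (lblp (bl 1) = bar 1) * (lblp (bl 2) = bar 2) *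
  (lblp (bl 3) = bar 3).
Proof.
by do !split; first [apply: lblp_bl | apply: lblp_pos]; clear -hn; lia.
Qed.

End Main.

End Crystals.

Theorem theorem5 (n s : nat) (hn : 4 <= n) (hs : 1 <= s)
  (sigma : B2_classical n s -> B2_classical n s) (hsigma : is_sigma sigma)
  (sigma1 : B2_classical n 1 -> B2_classical n 1) (hsigma1 : is_sigma sigma1)
  (R : tens (B2 sigma) (B2 sigma1) -> tens (B2 sigma1) (B2 sigma))
  (hR : affine_crystal_iso R) :
  (* (1) *)
  sends R (utab s) (utab 1) (utab 1) (utab s) /\
  (* (2) *)
  sends R (utab (s - 1)) (utab 1) [::] (utab s) /\
  (* (3) *)
  (forall k, k + 2 <= s ->
    sends R (utab k) (utab 1) (utab 1) (utab (k + 1) ++ [:: column (bar 2) (bar 1)])) /\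
  (* (4) *)
  sends R (utab s) [:: column (pos 1) (pos 3)]
    (utab 1) (utab (s - 1) ++ [:: column (pos 1) (pos 3)]) /\
  (* (5) *)
  (forall k, 1 <= k <= s - 1 ->
    sends R (utab k) [:: column (pos 1) (pos 3)]
      (utab 1) (utab (k - 1) ++ [:: column (pos 1) (pos 3); column (pos 3) (bar 3)])) /\
  (* (6) *)
  (forall k, 1 <= k <= s ->
    sends R (utab k) [:: column (pos 3) (pos 4)]
      (utab 1) (utab (k - 1) ++ [:: column (pos 3) (pos 4)])) /\
  (* (7) *)
  (forall k, 1 <= k <= s ->
    sends R (utab k) [:: column (pos 3) (bar 3)]
      (utab 1) (utab (k - 1) ++ [:: column (pos 3) (bar 3)])) /\
  (* (8) *)
  (forall k, 1 <= k <= s ->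
    sends R (utab k) [:: column (pos 1) (bar 2)]
      (utab 1) (utab (k - 1) ++ [:: column (pos 1) (bar 2)])) /\
  (* (9) *)
  (forall k, 2 <= k <= s ->
    sends R (utab k) [:: column (pos 3) (bar 2)]
      (utab 1) (utab (k - 2) ++ [:: column (pos 1) (pos 3)])) /\
  (* (10) *)
  sends R (utab s) [::] (utab 1) (utab (s - 1)) /\
  (* (11) *)
  (forall k, k <= s - 1 -> sends R (utab k) [::] [::] (utab k)) /\
  (* (12) *)
  sends R (utab 1) [:: column (bar 2) (bar 1)]
    (utab 1) [:: column (bar 2) (bar 1)] /\
  (* (13) *)
  (forall k, 2 <= k <= s ->
    sends R (utab k) [:: column (bar 2) (bar 1)] (utab 1) (utab (k - 2))) /\
  (* (14) *)
  (n = 4 -> forall k, 1 <= k <= s ->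
    sends R (utab k) [:: column (pos 3) (bar 4)]
      (utab 1) (utab (k - 1) ++ [:: column (pos 3) (bar 4)])).
Proof.
have m1 := R_us_u1 hn hs hsigma hsigma1 hR.
have tE := (tabp_cons, tabp_blk hn, lblps hn, subSS, subn0).
split; first by apply: (sends_maps hn m1); rewrite tE.
split; first by apply: (sends_maps hn (R_pred_u1 hn hs hsigma hsigma1 hR)); rewrite tE.
split=> [k hk|].
  by apply: (sends_maps hn (R_u_u1 hn hsigma hsigma1 hR hk)); rewrite !tE // cats1 addn1.
split.
  by apply: (sends_maps hn (R_us_13 hn hs hsigma hsigma1 hR)); rewrite !tE // cats1.
split=> [[//|k] hk|].
  have hk' : k.+1 < s by lia.
  apply: (sends_maps hn (R_u_13 hn hsigma hsigma1 hR hk')); rewrite !tE //.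
  by rewrite -!cats1 -catA.
split=> [[//|k] hk|].
  by apply: (sends_maps hn (R_u_34 hn hsigma hsigma1 hR hk)); rewrite !tE // cats1.
split=> [[//|k] hk|].
  by apply: (sends_maps hn (R_u_33bar hn hs hsigma hsigma1 hR hk)); rewrite !tE // cats1.
split=> [[//|k] hk|].
  by apply: (sends_maps hn (R_u_12bar hn hsigma hsigma1 hR hk)); rewrite !tE // cats1.
split=> [[//|[//|k]] hk|].
  by apply: (sends_maps hn (R_u_32bar hn hsigma hsigma1 hR hk)); rewrite !tE // cats1.
split; first by apply: (sends_maps hn (R_us_nil hn hs hsigma hsigma1 hR)); rewrite tE.
split=> [k hk|].
  have hk' : k < s by lia.
  by apply: (sends_maps hn (R_u_nil hn hs hsigma hsigma1 hR hk')); rewrite tE.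
split; first by apply: (sends_maps hn (R_u1_low hn hs hsigma hsigma1 hR)); rewrite !tE.
split=> [k hk|].
  by apply: (sends_maps hn (R_u_low hn hs hsigma hsigma1 hR hk)); rewrite !tE.
move=> n4 [//|k] hk.
have l5 : lblp n 5 = bar 4 by rewrite n4.
by apply: (sends_maps hn (R_u_34bar hn hsigma hsigma1 hR n4 hk)); rewrite !tE ?l5 // cats1.
Qed.
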